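(* For every $\nu>0$, the probability measure $\pi_\nu\propto\exp(-V_\nu)$ on $\mathbb{R}^d$ with $V_\nu(x)=\frac{d+\nu}{2}\ln(1+\|x\|^2)$ satisfies a weak Poincaré inequality with $$\beta_{\mathsf{WPI}}(r)=\frac2\nu+2\Big(\frac d\nu+1\Big)r^{-2/\nu}\quad\text{and}\quad\Phi(\cdot)=\operatorname{Osc}(\cdot)^2 .$$
   Context: Weak Poincaré inequality (WPI): a probability measure $\pi$ on $\mathbb{R}^d$ satisfies a WPI with weight $\beta_{\mathsf{WPI}}$ and functional $\Phi$ if $\beta_{\mathsf{WPI}}:(0,\infty)\to\mathbb{R}_+$ is non-increasing, $\Phi:L^2(\pi)\to[0,\infty]$ satisfies $\Phi(cf+a)=c^2\Phi(f)$ for all $a,c\in\mathbb{R}$, $f\in L^2(\pi)$, and for every $f\in\mathcal{C}^\infty(\mathbb{R}^d)$, $\operatorname{Var}_\pi(f)\le\beta_{\mathsf{WPI}}(r)\,\mathbb{E}_\pi[\|\nabla f\|^2]+r\,\Phi(f)$ for all $r>0$. Here $\operatorname{Osc}(f)=\sup f-\inf f$. *)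

(* Defs.v *)
From HB Require Import structures.
From mathcomp Require Import all_boot all_order all_algebra.
From mathcomp Require Import all_classical all_reals all_analysis.

Set Implicit Arguments.
Unset Strict Implicit.
Unset Printing Implicit Defensive.

Import Order.TTheory GRing.Theory Num.Theory.
Import numFieldNormedType.Exports.

Local Open Scope classical_set_scope.
Local Open Scope ring_scope.

Definition rV_display : measure_display.
Proof. exact: default_measure_display. Qed.

(* The sigma-algebra on R^n is generated by the coordinate functions, as the
   library does for n.-tuple; it is the Borel sigma-algebra of R^n. *)
Section measurable_rV.
Context {R : realType} (n : nat).

Definition rV_coord (i : 'I_n) (x : 'rV[R]_n) : R := x 0 i.

Let rV_set0 : g_sigma_preimage rV_coord set0.
Proof. exact: sigma_algebra0. Qed.

Let rV_setC A : g_sigma_preimage rV_coord A -> g_sigma_preimage rV_coord (~` A).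
Proof. exact: sigma_algebraC. Qed.

Let rV_bigcup (F : (set 'rV[R]_n)^nat) :
  (forall i, g_sigma_preimage rV_coord (F i)) ->
  g_sigma_preimage rV_coord (\bigcup_i (F i)).
Proof. exact: sigma_algebra_bigcup. Qed.

HB.instance Definition _ := @isMeasurable.Build rV_display
  'rV[R]_n (g_sigma_preimage rV_coord) rV_set0 rV_setC rV_bigcup.

Lemma measurable_rV_coord (i : 'I_n) : measurable_fun [set: 'rV[R]_n] (rV_coord i).
Proof.
move=> _ Y mY; rewrite setTI; apply: sub_sigma_algebra => /=.
rewrite -bigcup_seq/=; exists i => /=; first by rewrite mem_index_enum.
by exists Y => //; rewrite setTI.
Qed.

Lemma measurable_fun_rVP d (T : measurableType d) (f : T -> 'rV[R]_n) :
  (forall i, measurable_fun [set: T] (rV_coord i \o f)) ->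
  measurable_fun [set: T] f.
Proof.
move=> mf _ A mA; rewrite setTI; move: A mA.
have : g_sigma_preimage (fun i => rV_coord i \o f) `<=` @measurable _ T.
  apply: smallest_sub; first exact: sigma_algebra_measurable.
  move=> A; rewrite -bigcup_seq/= => -[i _ [B mB <-]].
  exact: mf.
by rewrite g_sigma_preimage_comp => + A mA; apply; exists A; rewrite ?setTI.
Qed.

End measurable_rV.

Section lebesgue_rV.
Context {R : realType}.

Definition cons_rV n (xv : measurableTypeR R * 'rV[R]_n) : 'rV[R]_n.+1 :=
  row_mx (const_mx (xv.1 : R) : 'rV_1) xv.2.

Definition uncons_rV n (x : 'rV[R]_n.+1) : measurableTypeR R * 'rV[R]_n :=
  (x 0 0, \row_j x 0 (lift 0 j)).

Lemma cons_rV0 n (xv : measurableTypeR R * 'rV[R]_n) : cons_rV xv 0 0 = xv.1.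
Proof.
transitivity (row_mx (const_mx (xv.1 : R) : 'rV_1) xv.2 0 (lshift n 0)).
  by congr (fun_of_matrix _ _ _); exact/val_inj.
by rewrite row_mxEl mxE.
Qed.

Lemma cons_rVS n (xv : measurableTypeR R * 'rV[R]_n) (j : 'I_n) :
  cons_rV xv 0 (lift 0 j) = xv.2 0 j.
Proof.
rewrite -(row_mxEr (const_mx (xv.1 : R) : 'rV_1) xv.2 0 j).
by congr (fun_of_matrix _ _ _); exact/val_inj.
Qed.

Lemma cons_rVK n : cancel (@cons_rV n) (@uncons_rV n).
Proof.
move=> xv; rewrite /uncons_rV cons_rV0 [RHS]surjective_pairing; congr pair.
by apply/rowP => j; rewrite mxE cons_rVS.
Qed.

Lemma measurable_cons_rV n : measurable_fun setT (@cons_rV n).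
Proof.
apply: measurable_fun_rVP => i; have [j|] := unliftP 0 i => ->.
  rewrite (_ : _ \o _ = rV_coord j \o snd); last first.
    by apply/funext => xv; rewrite /= /rV_coord cons_rVS.
  apply: measurableT_comp; [exact: measurable_rV_coord|exact: measurable_snd].
rewrite (_ : _ \o _ = fst); first exact: measurable_fst.
by apply/funext => xv; rewrite /= /rV_coord cons_rV0.
Qed.

Lemma measurable_uncons_rV n : measurable_fun setT (@uncons_rV n).
Proof.
apply: measurable_fun_pair; first exact: (@measurable_rV_coord _ _ 0).
apply: measurable_fun_rVP => i.
rewrite (_ : _ \o _ = rV_coord (lift 0 i)); first exact: measurable_rV_coord.
by apply/funext => x; rewrite /= /rV_coord mxE.
Qed.

Section step.
Variables (n : nat) (m : {sigma_finite_measure set 'rV[R]_n -> \bar R}).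
Local Open Scope ereal_scope.

Definition lebesgue_rV_step : set 'rV[R]_n.+1 -> \bar R :=
  pushforward (@lebesgue_measure R \x m) (@cons_rV n).

Let step0 : lebesgue_rV_step set0 = 0.
Proof. by rewrite /lebesgue_rV_step /pushforward preimage_set0 measure0. Qed.

Let step_ge0 A : 0 <= lebesgue_rV_step A.
Proof. by rewrite /lebesgue_rV_step /pushforward. Qed.

Let step_sigma_additive : semi_sigma_additive lebesgue_rV_step.
Proof.
have mf := @measurable_cons_rV n.
move=> F mF tF mUF; rewrite /lebesgue_rV_step /pushforward preimage_bigcup.
apply: measure_semi_sigma_additive.
- by move=> k; rewrite -[X in measurable X]setTI; exact: mf.
- apply/trivIsetP => /= i j _ _ ij; rewrite -preimage_setI.
  by move/trivIsetP : tF => /(_ _ _ _ _ ij) ->//; rewrite preimage_set0.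
- by rewrite -preimage_bigcup -[X in measurable X]setTI; exact: mf.
Qed.

HB.instance Definition _ := isMeasure.Build _ _ _ lebesgue_rV_step
  step0 step_ge0 step_sigma_additive.

Let step_sigma_finite : sigma_finite setT lebesgue_rV_step.
Proof.
have /sigma_finiteP[F [TF ndF Foo]] := sigma_finiteT (@lebesgue_measure R).
have /sigma_finiteP[G [TG ndG Goo]] := sigma_finiteT m.
exists (fun k => @uncons_rV n @^-1` (F k `*` G k)).
  apply/esym; rewrite -subTset => x _.
  have [i _ Fi] : (\bigcup_i F i) (uncons_rV x).1 by rewrite -TF.
  have [j _ Gj] : (\bigcup_i G i) (uncons_rV x).2 by rewrite -TG.
  exists (maxn i j) => //; split.
  - by move: Fi; exact/subsetPset/ndF/leq_maxl.
  - by move: Gj; exact/subsetPset/ndG/leq_maxr.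
move=> k; have [mF Fk] := Foo k; have [mG Gk] := Goo k; split.
  rewrite -[X in measurable X]setTI.
  by apply: measurable_uncons_rV => //; exact: measurableX.
rewrite /lebesgue_rV_step /pushforward -comp_preimage.
rewrite (_ : _ \o _ = id) ?preimage_id; last first.
  by apply/funext => xv; exact: cons_rVK.
by rewrite product_measure1E// lte_mul_pinfty// ge0_fin_numE.
Qed.

HB.instance Definition _ := Measure_isSigmaFinite.Build _ _ _ lebesgue_rV_step
  step_sigma_finite.

End step.

(* Lebesgue measure on R^n: the n-fold product of the Lebesgue measure on R,
   the unique point of R^0 having mass 1. *)
Fixpoint lebesgue_rV (n : nat) : {sigma_finite_measure set 'rV[R]_n -> \bar R} :=
  if n is k.+1 then lebesgue_rV_step (lebesgue_rV k) else \d_(0 : 'rV[R]_0).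

End lebesgue_rV.
Arguments lebesgue_rV : clear implicits.

Section calculus_rV.
Context {R : realType} (d : nat).
Implicit Types (f : 'rV[R]_d -> R) (x : 'rV[R]_d).

(* The library norm `|x| on 'rV_d is the max norm. *)
Definition enorm x : R := Num.sqrt (\sum_(i < d) x 0 i ^+ 2).

Definition partial (i : 'I_d) f : 'rV[R]_d -> R := 'D_(delta_mx 0 i) f.

Definition grad f x : 'rV[R]_d := \row_i partial i f x.

Fixpoint Ck (k : nat) f : Prop :=
  continuous f /\
  (if k is k'.+1 then
     forall i : 'I_d,
       (forall x, derivable f x (delta_mx 0 i)) /\ Ck k' (partial i f)
   else True).

Definition Cinfty f : Prop := forall k, Ck k f.

Definition Osc f : \bar R :=
  (ereal_sup (range (EFin \o f)) - ereal_inf (range (EFin \o f)))%E.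

End calculus_rV.

Section weak_poincare.
Context {R : realType} (d : nat).
Local Open Scope ereal_scope.

Definition has_density_propto_exp (V : 'rV[R]_d -> R)
    (pi : probability 'rV[R]_d R) : Prop :=
  exists2 Z : R, (0 < Z)%R &
    forall A, measurable A ->
      pi A = (Z^-1)%:E * \int[lebesgue_rV R d]_(x in A) (expR (- V x))%:E.

(* Elements of L^2 are represented by functions, so that Phi may depend on
   pointwise values, as the oscillation sup f - inf f does.  'V_pi[f] is +oo
   for a measurable f that is not square-integrable. *)
Definition weak_poincare (pi : probability 'rV[R]_d R) (beta : R -> R)
    (Phi : ('rV[R]_d -> R) -> \bar R) : Prop :=
  [/\ forall r : R, (0 < r)%R -> (0 <= beta r)%R,
      forall r s : R, (0 < r)%R -> (r <= s)%R -> (beta s <= beta r)%R,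
      forall f, f \in Lfun pi 2%:E -> 0 <= Phi f,
      forall (a c : R) f, f \in Lfun pi 2%:E ->
        Phi (fun x => c * f x + a)%R = (c ^+ 2)%:E * Phi f &
      forall f, Cinfty f -> forall r : R, (0 < r)%R ->
        'V_pi[f] <= (beta r)%:E * 'E_pi[fun x => (enorm (grad f x) ^+ 2)%R]
                    + r%:E * Phi f].

End weak_poincare.

Definition cauchy_potential {R : realType} (d : nat) (nu : R)
    (x : 'rV[R]_d) : R :=
  (d%:R + nu) / 2 * ln (1 + enorm x ^+ 2).

(* Main.v *)
Require Import Defs.
From HB Require Import structures.
From mathcomp Require Import all_boot all_order all_algebra.
From mathcomp Require Import all_classical all_reals all_analysis.
From mathcomp Require Import measurable_realfun.
From mathcomp Require Import ring lra.

(** The measure is a Gaussian mixture: writing t = exp (- tau),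
    (1 + |x|^2)^(- (d + nu) / 2) is proportional to the integral over tau of
    exp (- a tau - exp (- tau)) Q_tau(x), where a = nu / 2 and Q_tau is the
    centered Gaussian density on R^d whose coordinates have variance
    exp tau / 2, i.e. t has a Gamma(a) law.

    Let m(tau) be the mean of f and g(tau) the mean of |grad f|^2 under Q_tau.
    Given tau, the Gaussian Poincare inequality bounds the variance of f by
    exp tau / 2 * g(tau), and Gaussian integration by parts followed by
    Cauchy-Schwarz gives m'(tau)^2 <= d / 8 * exp tau * g(tau).  On tau <= T a
    weighted Hardy inequality for the Gamma weight, centered at tau = - ln a,
    then controls the fluctuation of m by exp T times the integral of g.  The
    remaining tau > T contribute at most Osc(f)^2 times a Gamma tail, and T is
    chosen so that this tail is at most r, which makes exp T of order
    r^(- 2 / nu).  For r > 1/4 the trivial bound Osc(f)^2 / 4 suffices.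

    All one-dimensional inequalities come from one device: a pointwise bound
    L + G' <= U integrated over an interval, with a sign for the boundary
    terms of G. *)

Set Implicit Arguments.
Unset Strict Implicit.
Unset Printing Implicit Defensive.

Import Order.TTheory GRing.Theory Num.Theory.
Import numFieldNormedType.Exports.

Local Open Scope classical_set_scope.
Local Open Scope ring_scope.

(** * Measures with densities and Gaussian measures on R^n *)

(** The Poincare constant [exp tau / 2] of the components is unbounded in [tau], which forces the
    cut at [T]. Nothing is known about [m] at [T], so the Hardy inequality is arranged to need
    nothing there: [m] is compared with its value at [- ln a], where the Gamma weight peaks, and the
    multiplier vanishes at [T]. Constants: put [k = max(1, a)]. The tail beyond [T] is at most
    [exp (- a T) / a], while [Gamma(a) >= (k / e)^a / a]; hence the choice
    [exp T = (e / k) r^(-1/a)]. The Poincare part then costs [exp T / 2 <= 2 r^(-1/a)] and the Hardy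
    part [4 (d / 8) (2 / a) r^(-1/a) = (2 d / nu) r^(-1/a)], which add up to
    [2 (d / nu + 1) r^(-2/nu)]. Only bounded [f] matter, since an infinite oscillation makes the
    right side infinite; such an [f] is shifted into [[0, M]]. Its gradient may still fail to be
    square-integrable, so gradient integrals are kept in the extended reals. *)

Section density.
Context d (T : measurableType d) (R : realType).
Variable mu : {measure set T -> \bar R}.
Variable f : T -> R.
Hypothesis mf : measurable_fun [set: T] f.
Hypothesis f0 : forall x, 0 <= f x.
Local Open Scope ereal_scope.

Import HBNNSimple.

(** Monotone convergence along [nnsfun_approx] reduces both sides to simple functions, where [nu] is
    evaluated on level sets. It serves both the Gaussian law on the line and the Cauchy measure. *)
Lemma ge0_integral_density (nu : {measure set T -> \bar R}) :
  (forall A, measurable A -> nu A = \int[mu]_(x in A) (f x)%:E) ->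
  forall h : T -> \bar R, measurable_fun [set: T] h -> (forall x, 0 <= h x) ->
  \int[nu]_x h x = \int[mu]_x (h x * (f x)%:E).
Proof.
move=> nuE h mh h0; pose h_ := nnsfun_approx measurableT mh.
have hE x : h x = limn (fun n => (h_ n x)%:E).
  by apply/esym/cvg_lim => //; exact: cvg_nnsfun_approx.
have -> : \int[nu]_x h x = limn (fun n => \int[nu]_x (h_ n x)%:E).
  under eq_integral do rewrite hE.
  apply: monotone_convergence => //.
  - by move=> n; exact/measurable_EFinP.
  - by move=> n x _; rewrite lee_fin.
  - by move=> x _ a b ab; rewrite lee_fin; exact/lefP/nd_nnsfun_approx.
have -> : \int[mu]_x (h x * (f x)%:E) =
    limn (fun n => \int[mu]_x ((h_ n x)%:E * (f x)%:E)).
  have hfE x : h x * (f x)%:E = limn (fun n => (h_ n x)%:E * (f x)%:E).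
    by apply/esym/cvg_lim => //; apply: cvgeZr => //; exact: cvg_nnsfun_approx.
  under eq_integral do rewrite hfE.
  apply: monotone_convergence => //.
  - by move=> n; apply: emeasurable_funM; exact/measurable_EFinP.
  - by move=> n x _; rewrite mule_ge0 ?lee_fin.
  - move=> x _ a b ab; rewrite lee_wpmul2r ?lee_fin//.
    exact/lefP/nd_nnsfun_approx.
congr (limn _); apply/funext => n.
under eq_integral do rewrite fimfunE -fsumEFin//.
rewrite ge0_integral_fsum//; last 2 first.
  - by move=> y; apply/measurable_EFinP/measurable_funM.
  - by move=> y x _; exact: nnfun_muleindic_ge0.
have -> : \int[mu]_x ((h_ n x)%:E * (f x)%:E) =
    \int[mu]_x (\sum_(y \in range (h_ n))
      (y * \1_(h_ n @^-1` [set y]) x)%:E * (f x)%:E).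
  apply: eq_integral => x _; rewrite fimfunE -fsumEFin// ge0_mule_fsuml// => y.
  exact: nnfun_muleindic_ge0.
rewrite ge0_integral_fsum//; last 2 first.
  - move=> y; apply: emeasurable_funM; apply/measurable_EFinP => //.
    exact: measurable_funM.
  - move=> y x _; apply: mule_ge0; last by rewrite lee_fin.
    exact: nnfun_muleindic_ge0.
apply: eq_fsbigr => y /[!inE] -[z _ <-].
under eq_integral do rewrite EFinM.
rewrite integralZl_indic_nnsfun// integral_indic// setIT nuE//.
under [RHS]eq_integral do rewrite EFinM -muleA.
rewrite ge0_integralZl//; last 3 first.
  - by apply: emeasurable_funM; exact/measurable_EFinP.
  - by move=> x _; rewrite mule_ge0 ?lee_fin.
  - by rewrite lee_fin.
congr (_ * _); rewrite integral_mkcond.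
apply: eq_integral => x _; rewrite patchE indicE.
by case: (x \in _); rewrite ?mul1e ?mul0e.
Qed.

Lemma probability_of_density : \int[mu]_x (f x)%:E = 1 ->
  exists P : probability T R,
    forall A, measurable A -> P A = \int[mu]_(x in A) (f x)%:E.
Proof.
move=> f1; pose P A := \int[mu]_(x in A) (f x)%:E.
have P0 : P set0 = 0 by rewrite /P integral_set0.
have P_ge0 A : 0 <= P A by apply: integral_ge0 => x _; rewrite lee_fin.
have PU : semi_sigma_additive P.
  move=> A mA tA mUA; rewrite /P ge0_integral_bigcup//.
  - apply: is_cvg_ereal_nneg_natsum_cond => n _ _.
    by apply: integral_ge0 => x _; rewrite lee_fin.
  - by apply/measurable_EFinP; exact: measurable_funTS.
  - by move=> x _; rewrite lee_fin.
pose PM := isMeasure.Build _ _ _ P P0 P_ge0 PU.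
pose PM' : {measure set T -> \bar R} := HB.pack P PM.
have PT : PM' setT = 1 by [].
pose PP := Measure_isProbability.Build _ _ _ PM' PT.
pose P' : probability T R := HB.pack P PM PP.
by exists P'.
Qed.

End density.

(** * Open sets and continuous functions on R^n are measurable *)

Section measurable_continuous_rV.
Context {R : realType} (n : nat).

Lemma measurable_ball_rV (x : 'rV[R]_n) (e : R) : measurable (ball x e).
Proof.
have [e0|e0] := leP e 0.
  rewrite (_ : ball x e = set0)// -subset0 => y [].
  by rewrite ltNge e0.
rewrite (_ : ball x e = \bigcap_(i in [set: 'I_n])
    (rV_coord i @^-1` ball (x 0 i) e)).
  apply: fin_bigcap_measurable => // i _; rewrite -[X in measurable X]setTI.
  by apply: measurable_rV_coord => //; exact: measurable_ball.
apply/seteqP; split => [y [_ xy] i _|y xy]; first exact: xy.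
by split => // i j; rewrite (ord1 i); exact: xy.
Qed.

(** The sigma-algebra is generated by coordinates, so openness has to be reduced to them: the balls
    with rational center and radius that lie in [U] are countably many and cover it. *)
Lemma open_measurable_rV (U : set 'rV[R]_n) : open U -> measurable U.
Proof.
move=> oU; pose B (p : 'rV[rat]_n * rat) : set 'rV[R]_n :=
  ball (\row_i ratr (p.1 0 i) : 'rV[R]_n) (ratr p.2).
rewrite (_ : U = \bigcup_p [set y | B p y /\ B p `<=` U]); last first.
  apply/seteqP; split => [x Ux|x [p _ /= [Bpx]]]; last exact.
  have /nbhs_ballP[e /= e0 xeU] : nbhs x U by exact: open_nbhs_nbhs.
  (* A radius [dl < e / 2] and a center within [dl] of [x]: the rational ball then contains [x] and
     stays in the [e]-ball around [x]. *)
  have [/= dl] := @rat_in_itvoo R _ _ (divr_gt0 e0 (ltr0n _ 2)).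
  rewrite in_itv/= => /andP[dl0 dle].
  have /choice[q qx] : forall i, exists q : rat, `|ratr q - x 0 i| < ratr dl :> R.
    move=> i; have xi : x 0 i - ratr dl < x 0 i + ratr dl by rewrite ltrD2l gtrN.
    by have [q] := rat_in_itvoo xi; rewrite in_itv/= -ltr_distl; exists q.
  exists (\row_i q i, dl) => //=; split.
    by split => // i j; rewrite /ball/= !mxE (ord1 i).
  move=> y [_ qy]; apply: xeU; split => // i j.
  rewrite /ball/= -(subrKA (ratr (q j))) (ord1 i) (le_lt_trans (ler_normD _ _))//.
  have := qy i j; rewrite /ball/= !mxE (ord1 i) => yj.
  by rewrite (splitr e) ltrD//; apply: lt_trans dle => //; rewrite distrC.
apply: countable_bigcupT_measurable => [|p]; first exact: countableP.
have [BU|BU] := pselect (B p `<=` U).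
  rewrite (_ : [set y | _] = B p); first exact: measurable_ball_rV.
  by apply/seteqP; split => [y []|].
by rewrite (_ : [set y | _] = set0)// -subset0 => y [].
Qed.

Lemma continuous_measurable_fun_rV (f : 'rV[R]_n -> R) :
  continuous f -> measurable_fun [set: 'rV[R]_n] f.
Proof.
move=> cf; apply: (measurability _ (RGenOInfty.measurableE R)).
move=> /= _ [_ [a ->]] <-; rewrite setTI; apply: open_measurable_rV.
by move/continuousP : cf; apply; exact: interval_open.
Qed.

End measurable_continuous_rV.

Section gaussian.
Context {R : realType}.
Implicit Types (c : R) (n : nat).

Definition sqnorm n (x : 'rV[R]_n) : R := \sum_(i < n) x 0 i ^+ 2.

Lemma sqnorm_ge0 n (x : 'rV[R]_n) : 0 <= sqnorm x.
Proof. by apply: sumr_ge0 => i _; rewrite sqr_ge0. Qed.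

Lemma enorm_sqr n (x : 'rV[R]_n) : enorm x ^+ 2 = sqnorm x.
Proof. by rewrite /enorm sqr_sqrtr// sqnorm_ge0. Qed.

Lemma sqnorm_cons n (x : R) (y : 'rV[R]_n) :
  sqnorm (cons_rV (x, y)) = x ^+ 2 + sqnorm y.
Proof.
rewrite /sqnorm big_ord_recl cons_rV0; congr (_ + _).
by apply: eq_bigr => i _; rewrite cons_rVS.
Qed.

Lemma measurable_sqnorm n : measurable_fun [set: 'rV[R]_n] (@sqnorm n).
Proof.
apply: (@measurable_sum _ _ _ _ _ _ (fun i (x : 'rV[R]_n) => x 0 i ^+ 2)) => i.
by apply: measurable_funX; exact: measurable_rV_coord.
Qed.

Lemma ge0_integral_lebesgue_rVS n (h : 'rV[R]_n.+1 -> \bar R) :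
  measurable_fun setT h -> (forall x, 0 <= h x)%E ->
  (\int[lebesgue_rV R n.+1]_x h x =
   \int[lebesgue_measure]_x \int[lebesgue_rV R n]_y h (cons_rV (x, y)))%E.
Proof.
move=> mh h0; rewrite [LHS](ge0_integral_pushforward (@measurable_cons_rV R n))//.
rewrite preimage_setT fubini_tonelli1//; last by move=> x; exact: h0.
by apply: measurableT_comp => //; exact: measurable_cons_rV.
Qed.

(** The variance is [1 / (2 * c)]; the mixture uses [c = exp (- tau)]. *)
Definition gauss_pdf c (x : R) : R := Num.sqrt (c / pi) * expR (- (c * x ^+ 2)).

Definition gauss1 c : probability (measurableTypeR R) R :=
  normal_prob 0 (Num.sqrt (2 * c))^-1.

Lemma gauss1E c : 0 < c -> forall A, measurable A ->
  gauss1 c A = (\int[lebesgue_measure]_(x in A) (gauss_pdf c x)%:E)%E.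
Proof.
move=> c0 A mA; apply: eq_integral => x _; congr EFin.
have s0 : (Num.sqrt (2 * c))^-1 != 0.
  by rewrite invr_neq0// gt_eqF// sqrtr_gt0 mulr_gt0.
rewrite normal_pdfE// /normal_peak /normal_fun subr0 exprVn sqr_sqrtr; last first.
  by rewrite mulr_ge0// ltW.
rewrite /gauss_pdf; congr (_ * expR _); last by field; rewrite gt_eqF.
rewrite -sqrtrV; last first.
  by rewrite mulrn_wge0// mulr_ge0 ?pi_ge0// invr_ge0 mulr_ge0// ltW.
have := @pi_gt0 R; move: (@pi R) => p p0; congr Num.sqrt.
by field; rewrite !gt_eqF.
Qed.

HB.instance Definition _ n := isMeasurableFun.Build _ _ _ _
  (@cons_rV R n) (@measurable_cons_rV R n).

(** The recursion copies that of [lebesgue_rV], so that inductions on the dimension go through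
    Tonelli along [cons_rV]. *)
Fixpoint gauss_rV c n : probability 'rV[R]_n R :=
  if n is k.+1 then
    distribution (gauss1 c \x gauss_rV c k)%E (@cons_rV R k)
  else \d_(0 : 'rV[R]_0).

Lemma ge0_integral_gauss_rVS c n (h : 'rV[R]_n.+1 -> \bar R) :
  measurable_fun setT h -> (forall x, 0 <= h x)%E ->
  (\int[gauss_rV c n.+1]_x h x =
   \int[gauss1 c]_x \int[gauss_rV c n]_y h (cons_rV (x, y)))%E.
Proof.
move=> mh h0; rewrite [LHS](ge0_integral_pushforward (@measurable_cons_rV R n))//.
rewrite preimage_setT fubini_tonelli1//; last by move=> x; exact: h0.
by apply: measurableT_comp => //; exact: measurable_cons_rV.
Qed.

Definition gauss_rV_pdf c n (x : 'rV[R]_n) : R :=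
  Num.sqrt (c / pi) ^+ n * expR (- (c * sqnorm x)).

Lemma gauss_pdf_ge0 c x : 0 <= gauss_pdf c x.
Proof. by rewrite mulr_ge0// ?sqrtr_ge0 ?expR_ge0. Qed.

Lemma gauss_rV_pdf_ge0 c n (x : 'rV[R]_n) : 0 <= gauss_rV_pdf c x.
Proof. by rewrite mulr_ge0// ?exprn_ge0 ?sqrtr_ge0 ?expR_ge0. Qed.

Lemma measurable_gauss_pdf c : measurable_fun setT (gauss_pdf c).
Proof.
by apply: measurable_funM => //; apply: measurableT_comp => //;
  apply: measurableT_comp => //; apply: measurable_funM.
Qed.

Lemma measurable_gauss_rV_pdf c n :
  measurable_fun [set: 'rV[R]_n] (@gauss_rV_pdf c n).
Proof.
apply: measurable_funM => //; apply: measurableT_comp => //.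
apply: measurableT_comp => //; apply: measurable_funM => //.
exact: measurable_sqnorm.
Qed.

Lemma gauss_rV_pdf_cons c n x (y : 'rV[R]_n) :
  gauss_rV_pdf c (cons_rV (x, y)) = gauss_pdf c x * gauss_rV_pdf c y.
Proof.
rewrite /gauss_rV_pdf /gauss_pdf sqnorm_cons exprS mulrDr opprD expRD.
by ring.
Qed.

Lemma ge0_integral_gauss1 c (h : R -> \bar R) : 0 < c ->
  measurable_fun setT h -> (forall x, 0 <= h x)%E ->
  (\int[gauss1 c]_x h x =
   \int[lebesgue_measure]_x (h x * (gauss_pdf c x)%:E))%E.
Proof.
move=> c0 mh h0.
exact: (@ge0_integral_density _ (measurableTypeR R) R lebesgue_measure _
  (measurable_gauss_pdf c) (gauss_pdf_ge0 c) (gauss1 c) (gauss1E c0) h mh h0).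
Qed.

Lemma ge0_integral_gauss_rV c n (h : 'rV[R]_n -> \bar R) : 0 < c ->
  measurable_fun setT h -> (forall x, 0 <= h x)%E ->
  (\int[gauss_rV c n]_x h x =
   \int[lebesgue_rV R n]_x (h x * (gauss_rV_pdf c x)%:E))%E.
Proof.
move=> c0; elim: n h => [|n IH] h mh h0.
  rewrite /= !integral_dirac//; last first.
    apply: emeasurable_funM => //.
    by apply/measurable_EFinP; exact: measurable_gauss_rV_pdf.
  rewrite /gauss_rV_pdf expr0 mul1r /sqnorm big_ord0 mulr0 oppr0 expR0.
  by rewrite mule1.
rewrite ge0_integral_gauss_rVS// ge0_integral_lebesgue_rVS; last 2 first.
- apply: emeasurable_funM => //.
  by apply/measurable_EFinP; exact: measurable_gauss_rV_pdf.
- by move=> x; rewrite mule_ge0// lee_fin gauss_rV_pdf_ge0.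
have mhc : measurable_fun setT (h \o @cons_rV R n).
  by apply: measurableT_comp => //; exact: measurable_cons_rV.
have mhx x : measurable_fun setT (fun y => h (cons_rV (x, y))).
  exact: (measurableT_comp mhc (pair1_measurable x)).
rewrite ge0_integral_gauss1//; last 2 first.
- apply: (measurable_fun_fubini_tonelli_F (h \o @cons_rV R n)) => // x.
  exact: h0.
- by move=> x; exact: integral_ge0.
apply: eq_integral => x _; rewrite IH//.
rewrite -ge0_integralZr//.
- apply: eq_integral => y _; rewrite gauss_rV_pdf_cons EFinM -muleA.
  by rewrite (muleC (gauss_rV_pdf c y)%:E).
- apply: emeasurable_funM => //.
  by apply/measurable_EFinP; exact: measurable_gauss_rV_pdf.
- by move=> y _; rewrite mule_ge0// lee_fin gauss_rV_pdf_ge0.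
- by rewrite lee_fin gauss_pdf_ge0.
Qed.

End gaussian.

(** * One-dimensional Gaussian inequalities *)

Section lyapunov.
Context {R : realType}.
Notation mu := (@lebesgue_measure R).

Lemma integrable_continuous_itvcc (p q : R) (f : R -> R) :
  {in `[p, q], continuous f} -> mu.-integrable `[p, q] (EFin \o f).
Proof.
move=> cf; apply: continuous_compact_integrable; first exact: segment_compact.
by apply: continuous_in_subspaceT => x; rewrite inE; exact: cf.
Qed.

Lemma integral_derive_itvcc (p q : R) (G G' : R -> R) : p <= q ->
  {in `[p, q], forall x : R, is_derive x 1 G (G' x)} ->
  {in `[p, q], continuous G'} ->
  (\int[mu]_(x in `[p, q]) (G' x)%:E = (G q - G p)%:E)%E.
Proof.
rewrite le_eqVlt => /predU1P[->|pq] dG cG'.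
  by rewrite set_itv1 integral_set1 subrr.
have cG x : x \in `[p, q] -> {for x, continuous G}.
  move=> /dG dGx; apply: differentiable_continuous.
  by apply/derivable1_diffP; exact: ex_derive.
rewrite (@continuous_FTC2 _ _ G)//.
- by apply: continuous_in_subspaceT => x; rewrite inE; exact: cG'.
- split.
  + by move=> x /subset_itv_oo_cc /dG dGx; exact: ex_derive.
  + by apply: cvg_at_right_filter; apply: cG; rewrite in_itv/= lexx ltW.
  + by apply: cvg_at_left_filter; apply: cG; rewrite in_itv/= lexx ltW.
- move=> x /subset_itv_oo_cc /dG dGx; rewrite derive1E.
  exact: derive_val.
Qed.

(** The integral of [G'] is the boundary term. [U] is extended-valued so that possibly infinite
    gradient integrals fit in. *)
Lemma integral_le_lyapunov (p q : R) (L G G' : R -> R) (U : R -> \bar R) :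
  p <= q ->
  {in `[p, q], forall x : R, is_derive x 1 G (G' x)} ->
  {in `[p, q], continuous G'} -> {in `[p, q], continuous L} ->
  measurable_fun `[p, q] U -> (forall x, 0 <= U x)%E ->
  {in `[p, q], forall x, ((L x + G' x)%:E <= U x)%E} ->
  (\int[mu]_(x in `[p, q]) (L x)%:E + (G q - G p)%:E
    <= \int[mu]_(x in `[p, q]) U x)%E.
Proof.
move=> pq dG cG' cL mU U0 LGU.
have iL := integrable_continuous_itvcc cL.
have iG := integrable_continuous_itvcc cG'.
rewrite -(integral_derive_itvcc pq dG cG') -integralD//=.
have iLG : mu.-integrable `[p, q] (fun x => (L x)%:E + (G' x)%:E)%E.
  exact: integrableD.
(* [L + G'] has no sign; it is compared with [U] through its positive part, which is also below [U]
   because [U >= 0]. *)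
rewrite integralE; apply: (@le_trans _ _
    (\int[mu]_(x in `[p, q]) (fun x => (L x)%:E + (G' x)%:E)^\+ x)%E).
  by rewrite leeBlDr ?leeDl ?integral_ge0//; exact: integrable_neg_fin_num.
apply: ge0_le_integral => //.
  by apply: measurable_funepos; exact: measurable_int iLG.
move=> x xpq; rewrite funeposE ge_max U0 andbT.
exact: LGU.
Qed.

Lemma ge0_integral_bigcup_le (D : (set R)^nat) (h : R -> \bar R) (C : \bar R) :
  nondecreasing_seq D -> (forall n, measurable (D n)) ->
  measurable_fun setT h -> (forall x, 0 <= h x)%E ->
  (forall n, \int[mu]_(x in D n) h x <= C)%E ->
  (\int[mu]_(x in \bigcup_n D n) h x <= C)%E.
Proof.
move=> ndD mD mh h0 hC.
have cv : (\int[mu]_(x in D n) h x)%E @[n --> \oo] -->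
    (\int[mu]_(x in \bigcup_n D n) h x)%E.
  apply: ge0_nondecreasing_set_cvg_integral => // n.
  exact: measurable_funTS.
rewrite -(cvg_lim _ cv)//; apply: lime_le; last exact: nearW.
by apply/cvg_ex; eexists; exact: cv.
Qed.

Lemma bigcup_itvNn : \bigcup_n `[- n%:R, n%:R]%classic = [set: R].
Proof.
apply/seteqP; split => // x _; exists (Num.truncn `|x|).+1 => //=.
rewrite in_itv/= -ler_norml; apply: ltW; exact: truncnS_gt.
Qed.

Lemma nondecreasing_itvNn :
  nondecreasing_seq (fun n => `[- n%:R, n%:R]%classic : set R).
Proof.
move=> m n mn; rewrite subsetEset; apply: subset_itvScc => /=;
  by rewrite bnd_simp ?lerN2 ler_nat.
Qed.

End lyapunov.

(** * Hardy inequality for the Gaussian on a half-line *)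

Section gauss1_poincare.
Context {R : realType}.
Notation mu := (@lebesgue_measure R).

Lemma is_derive_gauss_pdf (c x : R) :
  is_derive x 1 (gauss_pdf c) (- (2 * c * x) * gauss_pdf c x).
Proof.
rewrite /gauss_pdf; apply: is_derive_eq.
by rewrite /GRing.scale/=; ring.
Qed.

Lemma continuous_gauss_pdf (c : R) : continuous (gauss_pdf c).
Proof.
move=> x; apply: differentiable_continuous; apply/derivable1_diffP.
by have dq := is_derive_gauss_pdf c x; exact: ex_derive.
Qed.

Lemma is_derive_continuous (f f' : R -> R) :
  (forall x : R, is_derive x 1 f (f' x)) -> continuous f.
Proof.
move=> df x; apply: differentiable_continuous; apply/derivable1_diffP.
by have dfx := df x; exact: ex_derive.
Qed.

Variables (f f' : R -> R) (c : R).
Hypothesis c0 : 0 < c.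
Hypothesis df : forall x : R, is_derive x 1 f (f' x).
Hypothesis cf' : continuous f'.

Let F x := f x - f 0.

(* Completing the square gives
   2 c F^2 q x / (x + dl) + (F^2 q / (x + dl))' <= F'^2 q with q = gauss_pdf. *)
Let hardy_itv (dl B : R) : 0 < dl -> 0 <= B ->
  (\int[mu]_(x in `[0%R, B]) (2 * c * F x ^+ 2 * gauss_pdf c x * (x / (x + dl)))%:E
   <= \int[mu]_(x in `[0%R, B]) (f' x ^+ 2 * gauss_pdf c x)%:E)%E.
Proof.
move=> dl0 B0.
pose G x := F x ^+ 2 * gauss_pdf c x * (x + dl)^-1.
pose G' x := 2 * F x * f' x * gauss_pdf c x * (x + dl)^-1
  - 2 * c * F x ^+ 2 * gauss_pdf c x * (x / (x + dl))
  - F x ^+ 2 * gauss_pdf c x * (x + dl)^-1 ^+ 2.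
have cf := is_derive_continuous df.
have cF : continuous F by move=> x; apply: cvgB; [exact: cf|exact: cvg_cst].
have xdl x : x \in `[0, B] -> x + dl != 0.
  by rewrite in_itv/= => /andP[x0 _]; rewrite gt_eqF// ltr_wpDl.
have ci x : x \in `[0, B] -> {for x, continuous (fun x => (x + dl)^-1)}.
  move=> /xdl xdl0; apply: cvgV => //; apply: cvgD; first exact: cvg_id.
  exact: cvg_cst.
have cq : continuous (gauss_pdf c) by exact: continuous_gauss_pdf.
have cFq x : F x ^+ 2 * gauss_pdf c x @[x --> x] --> F x ^+ 2 * gauss_pdf c x.
  apply: cvgM; last exact: cq.
  by rewrite /GRing.exp/=; apply: cvgM; exact: cF.
have cL : {in `[0, B], continuous (fun x =>
    2 * c * F x ^+ 2 * gauss_pdf c x * (x / (x + dl)))}.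
  move=> x xB; apply: cvgM; last by apply: cvgM; [exact: cvg_id|exact: ci].
  under eq_cvg do rewrite -mulrA.
  by rewrite -mulrA; apply: cvgM; [exact: cvg_cst|exact: cFq].
have H := @integral_le_lyapunov R 0 B
  (fun x => 2 * c * F x ^+ 2 * gauss_pdf c x * (x / (x + dl)))
  G G' (fun x => (f' x ^+ 2 * gauss_pdf c x)%:E) B0.
apply: le_trans (H _ _ cL _ _ _).
- rewrite leeDl// lee_fin /G {2}/F subrr expr0n/= !mul0r subr0.
  apply: divr_ge0; last by rewrite addr_ge0// ltW.
  by apply: mulr_ge0; [exact: sqr_ge0|exact: gauss_pdf_ge0].
- move=> x xB; rewrite /G.
  have dq := is_derive_gauss_pdf c x; have dfx := df x.
  have ? := xdl _ xB.
  apply: is_derive_eq.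
  rewrite /G' /GRing.scale/= /F; field.
  by rewrite xdl.
- move=> x xB; apply: cvgB; first apply: cvgB; last 2 first.
  + exact: cL.
  + apply: cvgM; first exact: cFq.
    by rewrite /GRing.exp/=; apply: cvgM; exact: ci.
  + apply: cvgM; last exact: ci.
    apply: cvgM; last exact: cq.
    apply: cvgM; last exact: cf'.
    by apply: cvgM; [exact: cvg_cst|exact: cF].
- apply: measurable_funTS; apply/measurable_EFinP/measurable_funM.
    by apply: measurable_funX; exact: continuous_measurable_fun.
  exact: measurable_gauss_pdf.
- by move=> x; rewrite lee_fin mulr_ge0 ?sqr_ge0 ?gauss_pdf_ge0.
- move=> x xB; rewrite lee_fin /G' -subr_ge0.
  rewrite (_ : _ - _ = gauss_pdf c x * (f' x - F x * (x + dl)^-1) ^+ 2).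
    by rewrite mulr_ge0 ?sqr_ge0 ?gauss_pdf_ge0.
  by ring.
Qed.

(** The natural multiplier [F^2 q / x] is singular at 0, hence the shift [dl] in [hardy_itv], at the
    price of the factor [x / (x + dl)]. On a compact part of the open half-line this factor can be
    brought as close to 1 as desired. *)
Lemma gauss_hardy_pos :
  (\int[mu]_(x in `[0%R, +oo[) (2 * c * F x ^+ 2 * gauss_pdf c x)%:E
   <= \int[mu]_(x in `[0%R, +oo[) (f' x ^+ 2 * gauss_pdf c x)%:E)%E.
Proof.
have cf := is_derive_continuous df.
have mF : measurable_fun setT (fun x => 2 * c * F x ^+ 2 * gauss_pdf c x).
  apply: measurable_funM; last exact: measurable_gauss_pdf.
  apply: measurable_funM => //; apply: measurable_funX.
  by apply: measurable_funB => //; exact: continuous_measurable_fun.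
have mf' : measurable_fun setT (fun x => f' x ^+ 2 * gauss_pdf c x).
  apply: measurable_funM; last exact: measurable_gauss_pdf.
  by apply: measurable_funX; exact: continuous_measurable_fun.
have F0 x : 0 <= 2 * c * F x ^+ 2 * gauss_pdf c x.
  by rewrite mulr_ge0 ?gauss_pdf_ge0// mulr_ge0 ?sqr_ge0// mulr_ge0// ltW.
rewrite -integral_itv_obnd_cbnd; last first.
  by apply: measurable_funTS; exact/measurable_EFinP.
rewrite (_ : `]0, +oo[%classic =
    \bigcup_n `[n.+1%:R^-1, n.+1%:R]%classic :> set R); last first.
  apply/seteqP; split => [x /=|x [n _] /=]; last first.
    by rewrite !in_itv/= andbT => /andP[+ _]; apply: lt_le_trans.
  rewrite in_itv/= andbT => x0.
  exists (maxn (Num.truncn x) (Num.truncn x^-1)) => //=.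
  rewrite in_itv/= -[leRHS]invrK lef_pV2 ?posrE ?invr_gt0//.
  apply/andP; split; (apply: (le_trans (ltW (truncnS_gt _)));
    rewrite ler_nat ltnS) ; [exact: leq_maxr|exact: leq_maxl].
apply: ge0_integral_bigcup_le => //.
- move=> m n mn; rewrite subsetEset; apply: subset_itvScc => /=.
    by rewrite bnd_simp lef_pV2 ?posrE// ler_nat.
  by rewrite bnd_simp ler_nat.
- exact/measurable_EFinP.
(* Proving the bound with any factor [t < 1] on the left replaces the limit [dl -> 0]. *)
move=> n; apply/lee_mul01Pr => [|t /andP[t0 t1]].
  by apply: integral_ge0 => x _; rewrite lee_fin.
pose eta : R := n.+1%:R^-1.
have eta0 : 0 < eta by rewrite invr_gt0.
(* The solution of [eta / (eta + dl) = t], so that [x / (x + dl) >= t] for all [x >= eta]. *)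
pose dl := eta * (1 - t) / t.
have dl0 : 0 < dl by rewrite !mulr_gt0 ?invr_gt0 ?subr_gt0.
apply: (@le_trans _ _ (\int[mu]_(x in `[0%R, n.+1%:R]) (f' x ^+ 2 * gauss_pdf c x)%:E)%E);
  last first.
  apply: ge0_subset_integral => //.
  - by apply: measurable_funTS; exact/measurable_EFinP.
  - by move=> x _; rewrite lee_fin mulr_ge0 ?sqr_ge0 ?gauss_pdf_ge0.
  - by move=> x /=; rewrite !in_itv/= => /andP[->].
apply: le_trans (hardy_itv dl0 (ler0n _ _)).
have mL : measurable_fun (`[0, n.+1%:R]%classic : set R) (fun x =>
    (2 * c * F x ^+ 2 * gauss_pdf c x * (x / (x + dl)))%:E).
  apply/measurable_EFinP; apply: measurable_funM.
    exact: measurable_funTS.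
  apply: subspace_continuous_measurable_fun => //.
  apply: continuous_in_subspaceT => x; rewrite inE/= in_itv/= => /andP[x0 _].
  apply: cvgM; first exact: cvg_id.
  apply: cvgV; first by rewrite gt_eqF// ltr_wpDl.
  by apply: cvgD; [exact: cvg_id|exact: cvg_cst].
have etan : `[eta, n.+1%:R]%classic `<=` (`[0, n.+1%:R]%classic : set R).
  move=> x /=; rewrite !in_itv/= => /andP[xe ->]; rewrite andbT.
  by rewrite (le_trans _ xe)// ltW.
rewrite -ge0_integralZl//; last 3 first.
- by apply: measurable_funTS; exact/measurable_EFinP.
- by move=> x _; rewrite lee_fin.
- by rewrite lee_fin ltW.
apply: (@le_trans _ _ (\int[mu]_(x in `[eta, n.+1%:R])
    (2 * c * F x ^+ 2 * gauss_pdf c x * (x / (x + dl)))%:E)%E).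
  apply: ge0_le_integral => //.
  - by move=> x _; rewrite -EFinM lee_fin mulr_ge0// ltW.
  - apply: measurable_funTS; apply: measurable_funeM; exact/measurable_EFinP.
  - exact: measurable_funS mL.
  move=> x /=; rewrite in_itv/= => /andP[xe _].
  rewrite -EFinM lee_fin mulrC ler_wpM2l//.
  have x0 : 0 < x by exact: lt_le_trans xe.
  rewrite ler_pdivlMr ?addr_gt0// -subr_ge0.
  rewrite (_ : _ - _ = (x - eta) * (1 - t)); last by rewrite /dl; field; rewrite gt_eqF.
  by rewrite mulr_ge0 ?subr_ge0// ltW.
apply: ge0_subset_integral => //.
move=> x /=; rewrite in_itv/= => /andP[x0 _].
by rewrite lee_fin mulr_ge0// divr_ge0// addr_ge0// ltW.
Qed.

End gauss1_poincare.

Section gauss1_poincare_line.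
Context {R : realType}.
Notation mu := (@lebesgue_measure R).

Lemma ge0_integral_sym (h : R -> \bar R) :
  measurable_fun setT h -> (forall x, 0 <= h x)%E ->
  (\int[mu]_x h x = \int[mu]_(x in `[0%R, +oo[) h x
                   + \int[mu]_(x in `[0%R, +oo[) h (- x)%R)%E.
Proof.
move=> mh h0; have mhN : measurable_fun setT (h \o -%R) by exact: measurableT_comp.
rewrite (ge0_integration_by_substitution0 mhN)//=.
under [X in _ = (_ + X)%E]eq_integral do rewrite opprK.
rewrite -(setUv `[(0 : R), +oo[%classic) ge0_integral_setU//=; last 3 first.
- exact: measurableC.
- by rewrite setUv.
- by rewrite disj_set2E setICr eqxx.
congr (_ + _)%E; rewrite setCitvr -integral_itv_bndo_bndc//.
exact: measurable_funTS.
Qed.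

(** Fold the line at 0 and apply [gauss_hardy_pos] to [f] and to its reflection. Centering at [f 0]
    makes the boundary term at 0 vanish; [integral_sqr_mean_le] brings back the mean later. *)
Lemma gauss1_poincare (f f' : R -> R) (c : R) : 0 < c ->
  (forall x : R, is_derive x 1 f (f' x)) -> continuous f' ->
  (\int[gauss1 c]_x ((f x - f 0) ^+ 2)%:E
    <= ((2 * c)^-1)%:E * \int[gauss1 c]_x (f' x ^+ 2)%:E)%E.
Proof.
move=> c0 df cf'.
have cf := is_derive_continuous df.
have mF : measurable_fun setT (fun x => ((f x - f 0) ^+ 2)%:E).
  apply/measurable_EFinP; apply: measurable_funX.
  by apply: measurable_funB => //; exact: continuous_measurable_fun.
have mf' : measurable_fun setT (fun x => (f' x ^+ 2)%:E).
  by apply/measurable_EFinP; apply: measurable_funX; exact: continuous_measurable_fun.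
have mq : measurable_fun setT (fun x => (gauss_pdf c x)%:E).
  by apply/measurable_EFinP; exact: measurable_gauss_pdf.
rewrite -lee_pdivrMl ?invr_gt0 ?mulr_gt0//.
rewrite !ge0_integral_gauss1//; try by move=> x; rewrite lee_fin sqr_ge0.
rewrite ge0_integral_sym; last 2 first.
- exact: emeasurable_funM.
- by move=> x; rewrite -EFinM lee_fin mulr_ge0 ?sqr_ge0 ?gauss_pdf_ge0.
rewrite [leRHS]ge0_integral_sym; last 2 first.
- exact: emeasurable_funM.
- by move=> x; rewrite -EFinM lee_fin mulr_ge0 ?sqr_ge0 ?gauss_pdf_ge0.
have dfN (x : R) : is_derive x 1 (fun x => f (- x)) (- f' (- x)).
  have := df (- x) => dfx; apply: is_derive_eq.
  by rewrite /GRing.scale/=; ring.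
have cfN : continuous (fun x => - f' (- x)).
  move=> x; apply: (@cvgN _ R^o); apply: continuous_comp; last exact: cf'.
  by apply: (@cvgN _ R^o); exact: cvg_id.
rewrite invrK muleDr; last 2 first.
- by [].
- apply: ge0_adde_def; rewrite inE; apply: integral_ge0 => x _;
    by rewrite -EFinM lee_fin mulr_ge0 ?sqr_ge0 ?gauss_pdf_ge0.
have ZI (h : R -> R) : measurable_fun setT h ->
    ((2 * c)%:E * \int[mu]_(x in `[0%R, +oo[) ((h x ^+ 2)%:E * (gauss_pdf c x)%:E) =
    \int[mu]_(x in `[0%R, +oo[) (2 * c * h x ^+ 2 * gauss_pdf c x)%:E)%E.
  move=> mh; rewrite -ge0_integralZl//.
  - by apply: eq_integral => x _; rewrite -!EFinM mulrA.
  - apply: measurable_funTS; apply: emeasurable_funM => //.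
    by apply/measurable_EFinP; exact: measurable_funX.
  - by move=> x _; rewrite -EFinM lee_fin mulr_ge0 ?sqr_ge0 ?gauss_pdf_ge0.
  - by rewrite lee_fin mulr_ge0// ltW.
have mf : measurable_fun setT (fun x => f x - f 0).
  by apply: measurable_funB => //; exact: continuous_measurable_fun.
have pdfN x : gauss_pdf c (- x) = gauss_pdf c x by rewrite /gauss_pdf sqrrN.
apply: leeD.
  by rewrite ZI//; have := gauss_hardy_pos c0 df cf'.
under eq_integral do rewrite pdfN.
rewrite (ZI (fun x => f (- x) - f 0)); last exact: (measurableT_comp mf).
have := gauss_hardy_pos c0 dfN cfN; rewrite oppr0 => /le_trans; apply.
rewrite le_eqVlt; apply/orP; left; apply/eqP.
by apply: eq_integral => x _; rewrite sqrrN pdfN EFinM.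
Qed.

End gauss1_poincare_line.

Lemma integral_prob_cst d (T : measurableType d) (R : realType)
    (P : probability T R) (k : R) : (\int[P]_x k%:E = k%:E)%E.
Proof. by rewrite integral_cst//= probability_setT mule1. Qed.

(** * Gaussian integration by parts on the line *)

Section gauss1_moment.
Context {R : realType}.
Notation mu := (@lebesgue_measure R).

Lemma integral_gauss1_le (c : R) (h : R -> R) (C : \bar R) : 0 < c ->
  measurable_fun setT h -> (forall x, 0 <= h x) ->
  (forall n : nat, \int[mu]_(x in `[(- n%:R)%R, n%:R%R]) (h x * gauss_pdf c x)%:E <= C)%E ->
  (\int[gauss1 c]_x (h x)%:E <= C)%E.
Proof.
move=> c0 mh h0 hC.
rewrite ge0_integral_gauss1//; last exact/measurable_EFinP.
rewrite -bigcup_itvNn; under eq_integral do rewrite -EFinM.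
apply: ge0_integral_bigcup_le => //.
- exact: nondecreasing_itvNn.
- apply/measurable_EFinP; apply: measurable_funM => //.
  exact: measurable_gauss_pdf.
- by move=> x; rewrite lee_fin mulr_ge0// gauss_pdf_ge0.
Qed.

Lemma integral_itv_le_gauss1 (c : R) (h : R -> R) (p q : R) : 0 < c ->
  measurable_fun setT h -> (forall x, 0 <= h x) ->
  (\int[mu]_(x in `[p, q]) (h x * gauss_pdf c x)%:E
    <= \int[gauss1 c]_x (h x)%:E)%E.
Proof.
move=> c0 mh h0; rewrite ge0_integral_gauss1//; last exact/measurable_EFinP.
under [leRHS]eq_integral do rewrite -EFinM.
apply: ge0_subset_integral => //.
- apply/measurable_EFinP; apply: measurable_funM => //.
  exact: measurable_gauss_pdf.
- by move=> x _; rewrite lee_fin mulr_ge0// gauss_pdf_ge0.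
Qed.

Section ibp.
Variables (c : R) (F F' : R -> R).
Hypothesis c0 : 0 < c.
Hypothesis dF : forall x : R, is_derive x 1 F (F' x).
Hypothesis cF' : continuous F'.

(* Gaussian integration by parts: the boundary term of G over a symmetric
   interval is nonnegative as soon as F is. *)
Let G x := (2 * c)^-1 * (x * F x * gauss_pdf c x).
Let G' x := (2 * c)^-1 * (F x + x * F' x) * gauss_pdf c x
  - F x * x ^+ 2 * gauss_pdf c x.

Let is_derive_G (x : R) : is_derive x 1 G (G' x).
Proof.
rewrite /G; have dq := is_derive_gauss_pdf c x; have dFx := dF x.
apply: is_derive_eq; rewrite /G' /GRing.scale/=; field.
by rewrite gt_eqF.
Qed.

Let continuous_L : continuous (fun x => F x * x ^+ 2 * gauss_pdf c x).
Proof.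
have cF := is_derive_continuous dF; move=> x.
apply: cvgM; last exact: continuous_gauss_pdf.
by apply: cvgM; [exact: cF|exact: exprn_continuous].
Qed.

Let continuous_G' : continuous G'.
Proof.
have cF := is_derive_continuous dF; move=> x.
apply: cvgB; last exact: continuous_L.
apply: cvgM; last exact: continuous_gauss_pdf.
apply: cvgM; first exact: cvg_cst.
apply: cvgD; first exact: cF.
by apply: cvgM; [exact: cvg_id|exact: cF'].
Qed.

(** [F x * x^2 * q + G'] equals [(2 * c)^-1 * (F + x * F') * q] with [q = gauss_pdf c], which may be
    negative; the majorant [h] stands in for it so that only nonnegative functions are
    integrated. *)
Lemma gauss1_moment_le (h : R -> R) : measurable_fun setT h ->
  (forall x, 0 <= F x) -> (forall x, 0 <= h x) ->
  (forall x, (2 * c)^-1 * (F x + x * F' x) <= h x) ->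
  (\int[gauss1 c]_x (F x * x ^+ 2)%:E <= \int[gauss1 c]_x (h x)%:E)%E.
Proof.
move=> mh F0 h0 Fh; have cF := is_derive_continuous dF.
apply: integral_gauss1_le => //.
- apply: measurable_funM; first exact: continuous_measurable_fun.
  exact: measurable_funX.
- by move=> x; rewrite mulr_ge0 ?sqr_ge0.
move=> n; apply: le_trans (integral_itv_le_gauss1 (- n%:R) n%:R c0 mh h0).
have H := @integral_le_lyapunov R (- n%:R) n%:R
  (fun x => F x * x ^+ 2 * gauss_pdf c x) G G'
  (fun x => (h x * gauss_pdf c x)%:E).
apply: le_trans (H _ _ _ _ _ _ _) => //.
- rewrite leeDl// lee_fin /G subr_ge0 ler_wpM2l//.
    by rewrite invr_ge0 mulr_ge0// ltW.
  apply: (@le_trans _ _ 0).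
    by rewrite !mulNr oppr_le0 mulr_ge0 ?gauss_pdf_ge0// mulr_ge0.
  by rewrite mulr_ge0 ?gauss_pdf_ge0// mulr_ge0.
- by rewrite -subr_ge0 opprK addr_ge0.
- apply: measurable_funTS; apply/measurable_EFinP; apply: measurable_funM => //.
  exact: measurable_gauss_pdf.
- by move=> x; rewrite lee_fin mulr_ge0// gauss_pdf_ge0.
- move=> x _; rewrite lee_fin /G' addrC subrK.
  by rewrite ler_wpM2r ?gauss_pdf_ge0.
Qed.

End ibp.

(** The upper bound is [gauss1_moment_le] with [F = 1]. In the lower bound the boundary term has the
    wrong sign and must be shown to vanish. The lower bound matters when [K - f] replaces [f] in
    [gauss_rV_cov_sqnorm]. *)
Lemma gauss1_second_moment (c : R) : 0 < c ->
  (\int[gauss1 c]_x (x ^+ 2)%:E = ((2 * c)^-1)%:E)%E.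
Proof.
move=> c0; apply/eqP; rewrite eq_le; apply/andP; split.
  have d1 (x : R) : is_derive x 1 (fun=> 1 : R) 0 by exact: is_derive_cst.
  have := @gauss1_moment_le c (fun=> 1) (fun=> 0) c0 d1 (@cst_continuous _ _ _)
    (fun=> (2 * c)^-1).
  rewrite integral_prob_cst.
  under eq_integral do rewrite mul1r.
  apply => //.
  - by move=> x; rewrite invr_ge0 mulr_ge0// ltW.
  - by move=> x; rewrite mulr0 addr0 mulr1.
pose q := gauss_pdf c; pose k := (2 * c)^-1.
have k0 : 0 < k by rewrite invr_gt0 mulr_gt0.
(* Decay of the boundary term, from [exp (c x^2) >= c x^2]. *)
have qn (n : nat) : n.+1%:R * q n.+1%:R <= Num.sqrt (c / pi) / c * n.+1%:R^-1.
  rewrite /q /gauss_pdf mulrCA -mulrA ler_wpM2l ?sqrtr_ge0// expRN.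
  rewrite ler_pdivrMr ?expR_gt0// -invfM ler_pdivlMl ?mulr_gt0//.
  rewrite mulrAC -mulrA -expr2; apply: le_trans (expR_ge1Dx _).
  by rewrite lerDr.
have dG (x : R) : is_derive x 1 (fun x => - (k * (x * q x))) (x ^+ 2 * q x - k * q x).
  have dq := is_derive_gauss_pdf c x; rewrite /q; apply: is_derive_eq.
  by rewrite /GRing.scale/= /k; field; rewrite gt_eqF.
have cq : continuous q by exact: continuous_gauss_pdf.
have ckq : continuous (fun x => k * q x).
  by move=> x; apply: cvgM; [exact: cvg_cst|exact: cq].
have cxq : continuous (fun x : R => x ^+ 2 * q x).
  by move=> x; apply: cvgM; [exact: exprn_continuous|exact: cq].
have cG' : continuous (fun x : R => x ^+ 2 * q x - k * q x).
  by move=> x; apply: cvgB; [exact: cxq|exact: ckq].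
have m2 : measurable_fun setT (fun x : R => x ^+ 2) by exact: measurable_funX.
have kq (n : nat) : (\int[mu]_(x in `[(- n.+1%:R)%R, n.+1%:R%R]) (k * q x)%:E <=
    \int[gauss1 c]_x (x ^+ 2)%:E + (2 * k * (Num.sqrt (c / pi) / c) * n.+1%:R^-1)%:E)%E.
  have nn : - n.+1%:R <= n.+1%:R :> R by rewrite -subr_ge0 opprK addr_ge0.
  rewrite -leeBlDr//.
  apply: le_trans (integral_itv_le_gauss1 (- n.+1%:R) n.+1%:R c0 m2 (fun x => sqr_ge0 x)).
  have H := @integral_le_lyapunov R _ _ (fun x => k * q x) _ _ (fun x => (x ^+ 2 * q x)%:E) nn
     (fun x _ => dG x) (fun x _ => cG' x).
  apply: le_trans (H _ _ _ _) => //.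
  - rewrite -EFinN leeD2l// lee_fin lerNl opprD !opprK.
    rewrite mulNr mulrN opprK /q {2}/gauss_pdf sqrrN -/(gauss_pdf c n.+1%:R).
    have := ler_wpM2l (ltW k0) (qn n); rewrite -/q.
    move: (q _) (Num.sqrt _ / c) (n.+1%:R^-1) => u v w; lra.
  - by apply: measurable_funTS; apply/measurable_EFinP; exact: continuous_measurable_fun.
  - by move=> x; rewrite lee_fin mulr_ge0 ?sqr_ge0 ?gauss_pdf_ge0.
  - by move=> x _; rewrite lee_fin addrC subrK.
apply/lee_addgt0Pr => e e0.
pose C := 2 * k * (Num.sqrt (c / pi) / c).
(* With this [N] the boundary error [C / (N + 1)] is at most [e]; enlarging the interval to reach
   that size only increases the left side. *)
pose N := Num.truncn (C / e).
have -> : (k%:E = \int[gauss1 c]_x k%:E)%E.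
  by rewrite integral_prob_cst.
apply: integral_gauss1_le => // [x|n]; first exact: ltW.
apply: (@le_trans _ _ (\int[mu]_(x in `[(- (maxn n N).+1%:R)%R, (maxn n N).+1%:R%R])
    (k * q x)%:E)%E).
  apply: ge0_subset_integral => //.
  - by apply: measurable_funTS; apply/measurable_EFinP; exact: continuous_measurable_fun.
  - by move=> x _; rewrite lee_fin mulr_ge0 ?gauss_pdf_ge0// ltW.
  - apply/subsetPset/nondecreasing_itvNn.
    by rewrite (leq_trans (leq_maxl n N)).
apply: le_trans (kq _) _; apply: leeD => //; rewrite lee_fin -/C.
rewrite ler_pdivrMr// mulrC -ler_pdivrMr//.
apply: (le_trans (ltW (truncnS_gt _))); rewrite ler_nat ltnS.
exact: leq_maxr.
Qed.

End gauss1_moment.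

(** * Tensorization *)

Section bounded_mean.
Context d (T : measurableType d) (R : realType) (P : probability T R).

Lemma integrable_bounded_prob (f : T -> R) (K : R) :
  measurable_fun [set: T] f -> (forall x, `|f x| <= K) ->
  P.-integrable [set: T] (EFin \o f).
Proof.
move=> mf fK; apply: measurable_bounded_integrable => //.
  by rewrite /= probability_setT ltry.
exists K; split; first exact: num_real.
by move=> M KM x _ /=; rewrite (le_trans (fK x))// ltW.
Qed.

Lemma Rintegral_prob_cst (k : R) : \int[P]_x k = k.
Proof. by rewrite /Rintegral integral_prob_cst. Qed.

Lemma EFin_Rintegral (f : T -> R) (K : R) :
  measurable_fun [set: T] f -> (forall x, `|f x| <= K) ->
  (\int[P]_x f x)%:E = (\int[P]_x (f x)%:E)%E.
Proof.
move=> mf fK; rewrite /Rintegral fineK//.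
by apply: integrable_fin_num => //; exact: integrable_bounded_prob fK.
Qed.

Lemma norm_Rintegral_prob_le (f : T -> R) (K : R) :
  measurable_fun [set: T] f -> (forall x, `|f x| <= K) ->
  `|\int[P]_x f x| <= K.
Proof.
move=> mf fK; have iF := integrable_bounded_prob mf fK.
apply: le_trans (le_normr_Rintegral _ _) _ => //.
rewrite -[leRHS]Rintegral_prob_cst; apply: le_Rintegral => //.
- apply: (@integrable_bounded_prob _ K); first exact: measurableT_comp.
  by move=> x; rewrite normr_id.
- apply: (@integrable_bounded_prob _ `|K|) => // x; exact: measurable_cst.
Qed.

Lemma integral_sqr_dev (f : T -> R) (K k : R) :
  measurable_fun [set: T] f -> (forall x, `|f x| <= K) ->
  (\int[P]_x ((f x - k) ^+ 2)%:E =
   \int[P]_x ((f x - \int[P]_x f x) ^+ 2)%:E + ((\int[P]_x f x - k) ^+ 2)%:E)%E.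
Proof.
move=> mf fK; set m := \int[P]_x f x.
have iF := integrable_bounded_prob mf fK.
have K0 : 0 <= K by exact: le_trans (fK point).
have mfk u : measurable_fun setT (fun x => f x - u) by exact: measurable_funB.
have fk x u : `|f x - u| <= K + `|u|.
  by rewrite (le_trans (ler_normB _ _))// lerD2r.
have i2 u : P.-integrable setT (fun x => ((f x - u) ^+ 2)%:E).
  apply: (@integrable_bounded_prob _ ((K + `|u|) ^+ 2)).
    exact: measurable_funX.
  move=> x; rewrite normrX ler_sqr ?nnegrE// addr_ge0//.
have i1 u v : P.-integrable setT (fun x => (v * (f x - u))%:E).
  apply: (@integrable_bounded_prob _ (`|v| * (K + `|u|))).
    exact: measurable_funM.
  by move=> x; rewrite normrM ler_wpM2l.
transitivity (\int[P]_x (((f x - m) ^+ 2)%:E +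
    ((2 * (m - k) * (f x - m))%:E + ((m - k) ^+ 2)%:E)))%E.
  by apply: eq_integral => x _; rewrite -!EFinD; congr EFin; ring.
have ic : P.-integrable setT (fun=> ((m - k) ^+ 2)%:E).
  by apply: (@integrable_bounded_prob _ `|(m - k) ^+ 2|).
rewrite integralD//; last exact: integrableD.
congr (_ + _)%E; rewrite integralD//= integral_prob_cst.
rewrite -[RHS]add0e; congr (_ + _)%E.
under eq_integral do rewrite EFinM.
have i0 : P.-integrable setT (fun x => (f x - m)%:E).
  by have := i1 m 1; under eq_fun do rewrite mul1r.
rewrite integralZl//=; under eq_integral do rewrite EFinB.
rewrite integralB//=; last first.
  by apply: (@integrable_bounded_prob _ `|m|).
rewrite integral_prob_cst -(EFin_Rintegral mf fK) -/m.
by rewrite -EFinB subrr mule0.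
Qed.

Lemma sqr_Rintegral_le (f : T -> R) (K k : R) :
  measurable_fun [set: T] f -> (forall x, `|f x| <= K) ->
  (((\int[P]_x f x - k) ^+ 2)%:E <= \int[P]_x ((f x - k) ^+ 2)%:E)%E.
Proof.
move=> mf fK; rewrite (integral_sqr_dev _ mf fK) leeDr//.
by apply: integral_ge0 => x _; rewrite lee_fin sqr_ge0.
Qed.

Lemma integral_sqr_mean_le (f : T -> R) (K k : R) :
  measurable_fun [set: T] f -> (forall x, `|f x| <= K) ->
  (\int[P]_x ((f x - \int[P]_x f x) ^+ 2)%:E <= \int[P]_x ((f x - k) ^+ 2)%:E)%E.
Proof.
move=> mf fK; rewrite (integral_sqr_dev k mf fK) leeDl//.
by rewrite lee_fin sqr_ge0.
Qed.

End bounded_mean.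

Section tensorization.
Context d1 d2 (T1 : measurableType d1) (T2 : measurableType d2) (R : realType).
Variables (P1 : probability T1 R) (P2 : probability T2 R).
Local Open Scope ereal_scope.

Lemma ge0_le_integral_prod1 (u v : T1 * T2 -> \bar R) :
  measurable_fun setT u -> measurable_fun setT v ->
  (forall z, 0 <= u z) -> (forall z, 0 <= v z) ->
  (forall x, \int[P2]_y u (x, y) <= \int[P2]_y v (x, y)) ->
  \int[P1 \x P2]_z u z <= \int[P1 \x P2]_z v z.
Proof.
move=> mu mv u0 v0 uv; rewrite !fubini_tonelli1//.
apply: ge0_le_integral => //.
- by move=> x _; exact: integral_ge0.
- exact: measurable_fun_fubini_tonelli_F.
- exact: measurable_fun_fubini_tonelli_F.
- by move=> x _; exact: uv.
Qed.

Lemma ge0_le_integral_prod2 (u v : T1 * T2 -> \bar R) :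
  measurable_fun setT u -> measurable_fun setT v ->
  (forall z, 0 <= u z) -> (forall z, 0 <= v z) ->
  (forall y, \int[P1]_x u (x, y) <= \int[P1]_x v (x, y)) ->
  \int[P1 \x P2]_z u z <= \int[P1 \x P2]_z v z.
Proof.
move=> mu mv u0 v0 uv; rewrite !fubini_tonelli2//.
apply: ge0_le_integral => //.
- by move=> y _; exact: integral_ge0.
- exact: measurable_fun_fubini_tonelli_G.
- exact: measurable_fun_fubini_tonelli_G.
- by move=> y _; exact: uv.
Qed.

Variables (f : T1 * T2 -> R) (K : R).
Hypotheses (mf : measurable_fun setT f) (fK : forall z, (`|f z| <= K)%R).

Let fx x := (\int[P2]_y f (x, y))%R.
Let fy y := (\int[P1]_x f (x, y))%R.

Let imf : (P1 \x P2).-integrable setT (EFin \o f).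
Proof. exact: (@integrable_bounded_prob _ _ _ (P1 \x P2)) fK. Qed.

Let mf1 x : measurable_fun setT (fun y => f (x, y)).
Proof. exact: measurableT_comp. Qed.

Let mf2 y : measurable_fun setT (fun x => f (x, y)).
Proof. exact: measurableT_comp. Qed.

Let mfx : measurable_fun setT fx.
Proof.
by apply: measurableT_comp => //; exact: measurable_fubini_F imf.
Qed.

Let mfy : measurable_fun setT fy.
Proof.
by apply: measurableT_comp => //; exact: measurable_fubini_G imf.
Qed.

Let fyK y : (`|fy y| <= K)%R.
Proof. exact: norm_Rintegral_prob_le. Qed.

Lemma Rintegral_prod2 : (\int[P1 \x P2]_z f z = \int[P2]_y \int[P1]_x f (x, y))%R.
Proof.
apply: EFin_inj; rewrite (EFin_Rintegral _ mfy fyK) (EFin_Rintegral _ mf fK).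
rewrite -integral21_prod_meas1//; apply: eq_integral => y _.
by rewrite /fubini_G (EFin_Rintegral _ (mf2 y) (fun x => fK (x, y))).
Qed.

(** Fix [x] and center [f (x, _)] at its own mean [fx x]: the deviation from [M] splits into the
    first term and [(fx x - M)^2]. Since [M] is also the mean of [fy], [fx x - M] is the mean over
    [y] of [f (x, y) - fy y], and Jensen's inequality gives the second term. *)
Lemma variance_tensorization :
  \int[P1 \x P2]_z ((f z - \int[P1 \x P2]_z f z) ^+ 2)%:E <=
  \int[P1 \x P2]_z ((f z - \int[P2]_y f (z.1, y)) ^+ 2)%:E +
  \int[P1 \x P2]_z ((f z - \int[P1]_x f (x, z.2)) ^+ 2)%:E.
Proof.
set M := (\int[P1 \x P2]_z f z)%R.
have mfx1 : measurable_fun setT (fun z : T1 * T2 => fx z.1).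
  exact: measurableT_comp.
have mfy2 : measurable_fun setT (fun z : T1 * T2 => fy z.2).
  exact: measurableT_comp.
have m2 (g : T1 * T2 -> R) : measurable_fun setT g ->
    measurable_fun setT (fun z => ((f z - g z) ^+ 2)%:E).
  move=> mg; apply/measurable_EFinP; apply: measurable_funX.
  exact: measurable_funB.
rewrite -ge0_integralD//; last 4 first.
- by move=> z _; rewrite lee_fin sqr_ge0.
- exact: m2.
- by move=> z _; rewrite lee_fin sqr_ge0.
- exact: m2.
have MfE : M = (\int[P2]_y fy y)%R by rewrite /M Rintegral_prod2.
apply: ge0_le_integral_prod1.
- exact: m2.
- by apply: emeasurable_funD; exact: m2.
- by move=> z; rewrite lee_fin sqr_ge0.
- by move=> z; rewrite adde_ge0// lee_fin sqr_ge0.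
move=> x /=; rewrite ge0_integralD//; last 4 first.
- by move=> y _; rewrite lee_fin sqr_ge0.
- apply: (measurableT_comp (m2 _ mfx1)) => //.
- by move=> y _; rewrite lee_fin sqr_ge0.
- apply: (measurableT_comp (m2 _ mfy2)) => //.
rewrite (integral_sqr_dev _ _ (mf1 x) (fun y => fK (x, y))) leeD2l//.
have mg : measurable_fun setT (fun y => f (x, y) - fy y)%R by exact: measurable_funB.
have gK y : (`|f (x, y) - fy y| <= K + K)%R.
  by rewrite (le_trans (ler_normB _ _))// lerD.
have := @sqr_Rintegral_le _ _ _ P2 _ _ 0%R mg gK; rewrite subr0.
rewrite RintegralB//; last 2 first.
- exact: (@integrable_bounded_prob _ _ _ P2) (fun y => fK (x, y)).
- exact: (@integrable_bounded_prob _ _ _ P2) fyK.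
rewrite -MfE => /le_trans; apply; rewrite le_eqVlt; apply/orP; left.
by apply/eqP; apply: eq_integral => y _; rewrite subr0.
Qed.

End tensorization.

(** * C^1 functions on R^n and their slices *)

Section C1_rV.
Context {R : realType}.

(** The partial derivatives are carried as data, so that those of a slice of [f] are simply slices
    of [p]. *)
Definition C1_rV n (f : 'rV[R]_n -> R) (p : 'I_n -> 'rV[R]_n -> R) : Prop :=
  [/\ continuous f, forall i, continuous (p i) &
      forall i x, is_derive x (delta_mx 0 i : 'rV[R]_n) f (p i x)].

(** A directional derivative sees only the line, so it transfers between a function and its slices
    in another space. *)
Lemma is_derive_line (V W : normedModType R) (f : V -> R) (g : W -> R)
    (x v : V) (y w : W) (df : R) :
  (forall h : R, f (h *: v + x) = g (h *: w + y)) ->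
  is_derive x v f df -> is_derive y w g df.
Proof.
move=> fg [dfx <-].
have E : (fun h : R => h^-1 *: ((f \o shift x) (h *: v) - f x)) =
         (fun h : R => h^-1 *: ((g \o shift y) (h *: w) - g y)).
  apply/funext => h; rewrite /= fg; congr (_ *: (_ - _)).
  by have := fg 0; rewrite !scale0r !add0r.
by apply: DeriveDef; rewrite /derivable /derive -E.
Qed.

Lemma cvg_rV (T : topologicalType) n (g : T -> 'rV[R]_n) (x : T) :
  (forall i, g t 0 i @[t --> x] --> g x 0 i) -> {for x, continuous g}.
Proof.
move=> cg; apply/cvg_ballP => e e0.
have : \forall t \near x, forall i, ball (g x 0 i) e (g t 0 i).
  by apply: filter_forall => i; have /cvg_ballP := cg i; exact.
apply: filterS => t H; split => // i j; rewrite (ord1 i); exact: H.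
Qed.

Lemma continuous_cons1 n (y : 'rV[R]_n) : continuous (fun x : R => cons_rV (x, y)).
Proof.
move=> x; apply: cvg_rV => i; have [j|] := unliftP 0 i => ->.
  by under eq_cvg do rewrite cons_rVS; rewrite cons_rVS; exact: cvg_cst.
by under eq_cvg do rewrite cons_rV0; rewrite cons_rV0; exact: cvg_id.
Qed.

Lemma continuous_cons2 n (x : R) : continuous (fun y : 'rV[R]_n => cons_rV (x, y)).
Proof.
move=> y; apply: cvg_rV => i; have [j|] := unliftP 0 i => ->.
  by under eq_cvg do rewrite cons_rVS; rewrite cons_rVS; exact: coord_continuous.
rewrite (_ : (fun t => _) = cst (cons_rV (x, y) 0 0)).
  exact: (@cst_continuous _ _ (cons_rV (x, y) 0 0) y).
by apply/funext => t /=; rewrite !cons_rV0.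
Qed.

Lemma cons_rVD1 n (h x : R) (y : 'rV[R]_n) :
  cons_rV (h * 1 + x, y) = h *: delta_mx 0 0 + cons_rV (x, y).
Proof.
apply/rowP => i; rewrite [RHS]mxE [X in _ = X + _]mxE [X in _ = _ * X + _]mxE.
have [j|] := unliftP 0 i => ->; last by rewrite !cons_rV0 !eqxx.
by rewrite !cons_rVS/= mulr0 add0r.
Qed.

Lemma cons_rVD2 n (h x : R) (j : 'I_n) (y : 'rV[R]_n) :
  cons_rV (x, h *: delta_mx 0 j + y) =
  h *: delta_mx 0 (lift 0 j) + cons_rV (x, y).
Proof.
apply/rowP => i; rewrite [RHS]mxE [X in _ = X + _]mxE [X in _ = _ * X + _]mxE.
have [k|] := unliftP 0 i => ->; last by rewrite !cons_rV0/= mulr0 add0r.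
by rewrite !cons_rVS !mxE eqxx/= (inj_eq lift_inj).
Qed.

Section slices.
Variables (n : nat) (f : 'rV[R]_n.+1 -> R) (p : 'I_n.+1 -> 'rV[R]_n.+1 -> R).
Hypothesis fp : C1_rV f p.

Lemma C1_rV_slice2 (x : R) : C1_rV (fun y => f (cons_rV (x, y)))
  (fun j y => p (lift 0 j) (cons_rV (x, y))).
Proof.
have [cf cp dfp] := fp; split.
- move=> y; apply: continuous_comp; [exact: continuous_cons2|exact: cf].
- move=> j y; apply: continuous_comp; [exact: continuous_cons2|exact: cp].
- move=> j y; apply: is_derive_line (dfp (lift 0 j) (cons_rV (x, y))) => h.
  by rewrite cons_rVD2.
Qed.

Lemma is_derive_slice1 (x : R) (y : 'rV[R]_n) :
  is_derive x 1 (fun x => f (cons_rV (x, y))) (p 0 (cons_rV (x, y))).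
Proof.
have [cf cp dfp] := fp.
apply: is_derive_line (dfp 0 (cons_rV (x, y))) => h.
by rewrite -cons_rVD1.
Qed.

Lemma continuous_slice1 (y : 'rV[R]_n) : continuous (fun x => p 0 (cons_rV (x, y))).
Proof.
have [cf cp dfp] := fp.
by move=> x; apply: continuous_comp; [exact: continuous_cons1|exact: cp].
Qed.

End slices.

End C1_rV.

(** * Poincare and moment inequalities for the Gaussian on R^n *)

Section gauss_rV_inequalities.
Context {R : realType}.
Variable c : R.
Hypothesis c0 : 0 < c.
Let kap : R := (2 * c)^-1.
Let kap0 : 0 < kap. Proof. by rewrite invr_gt0 mulr_gt0. Qed.

Lemma ge0_integral_gauss_rV_prod n (h : 'rV[R]_n.+1 -> \bar R) :
  measurable_fun setT h -> (forall x, 0 <= h x)%E ->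
  (\int[gauss_rV c n.+1]_x h x =
   \int[gauss1 c \x gauss_rV c n]_z h (cons_rV z))%E.
Proof.
by move=> mh h0; rewrite [LHS](ge0_integral_pushforward (@measurable_cons_rV R n)).
Qed.

Lemma Rintegral_gauss_rV_prod n (f : 'rV[R]_n.+1 -> R) (K : R) :
  measurable_fun setT f -> (forall x, `|f x| <= K) ->
  \int[gauss_rV c n.+1]_x f x = \int[(gauss1 c \x gauss_rV c n)%E]_z f (cons_rV z).
Proof.
move=> mf fK; rewrite /Rintegral; congr fine.
rewrite [LHS](integral_pushforward (@measurable_cons_rV R n))//.
- exact/measurable_EFinP.
- apply: (@integrable_bounded_prob _ _ _ (gauss1 c \x gauss_rV c n)%E _ K).
    by apply: measurableT_comp => //; exact: measurable_cons_rV.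
  by move=> z; exact: fK.
Qed.

Lemma measurable_C1 n (f : 'rV[R]_n -> R) p : C1_rV f p -> measurable_fun setT f.
Proof. by case=> cf _ _; exact: continuous_measurable_fun_rV. Qed.

Lemma measurable_C1_sqr n (f : 'rV[R]_n -> R) p i : C1_rV f p ->
  measurable_fun setT (fun x => p i x ^+ 2).
Proof.
by case=> _ cp _; apply: measurable_funX; exact: continuous_measurable_fun_rV.
Qed.

Lemma measurable_C1_grad n (f : 'rV[R]_n -> R) p : C1_rV f p ->
  measurable_fun setT (fun x => \sum_i p i x ^+ 2).
Proof.
move=> fp; apply: (@measurable_sum _ _ _ _ _ _ (fun i x => p i x ^+ 2)) => i.
exact: measurable_C1_sqr fp.
Qed.

(** Induction by [variance_tensorization]: the last [n] coordinates are covered by the induction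
    hypothesis, the first one by [gauss1_poincare]. The two gradient parts add up, so the constant
    does not grow with [n]. *)
Lemma gauss_rV_poincare n (f : 'rV[R]_n -> R) p (K : R) :
  C1_rV f p -> (forall x, `|f x| <= K) ->
  (\int[gauss_rV c n]_x ((f x - \int[gauss_rV c n]_x f x) ^+ 2)%:E <=
   \int[gauss_rV c n]_x (kap * \sum_i p i x ^+ 2)%:E)%E.
Proof.
elim: n f p => [|n IH] f p fp fK.
  rewrite integral0_eq; first by apply: integral_ge0 => x _; rewrite big_ord0 mulr0.
  move=> x _; suff -> : f = cst (f x) by rewrite /= Rintegral_prob_cst subrr expr0n.
  by apply/funext => y; rewrite /= (_ : y = x)//; apply/rowP => -[].
have mf := measurable_C1 fp.
have mfc : measurable_fun setT (f \o @cons_rV R n).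
  by apply: measurableT_comp => //; exact: measurable_cons_rV.
rewrite !ge0_integral_gauss_rV_prod; last 4 first.
- apply/measurable_EFinP; apply: measurable_funM => //; exact: measurable_C1_grad fp.
- move=> x; rewrite lee_fin mulr_ge0 ?(ltW kap0)// sumr_ge0// => i _.
  exact: sqr_ge0.
- by apply/measurable_EFinP; apply: measurable_funX; exact: measurable_funB.
- by move=> x; rewrite lee_fin sqr_ge0.
rewrite (Rintegral_gauss_rV_prod mf fK).
have fcK z : `|(f \o @cons_rV R n) z| <= K by exact: fK.
apply: le_trans (variance_tensorization (gauss1 c) (gauss_rV c n) mfc fcK) _.
have mp0 : measurable_fun setT (fun z => kap * p 0 (cons_rV z) ^+ 2).
  apply: measurable_funM => //.
  by apply: (measurableT_comp (measurable_C1_sqr 0 fp)); exact: measurable_cons_rV.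
have mpS : measurable_fun setT
    (fun z => kap * \sum_(j < n) p (lift 0 j) (cons_rV z) ^+ 2).
  apply: measurable_funM => //.
  apply: (@measurable_sum _ _ _ _ _ _ (fun j z => p (lift 0 j) (cons_rV z) ^+ 2)) => j.
  apply: (measurableT_comp (measurable_C1_sqr (lift 0 j) fp)).
  exact: measurable_cons_rV.
have pS0 z : 0 <= kap * \sum_(j < n) p (lift 0 j) (cons_rV z) ^+ 2.
  by rewrite mulr_ge0 ?(ltW kap0)// sumr_ge0// => j _; exact: sqr_ge0.
have p00 z : 0 <= kap * p 0 (cons_rV z) ^+ 2.
  by rewrite mulr_ge0 ?(ltW kap0)// sqr_ge0.
under [leRHS]eq_integral do rewrite big_ord_recl mulrDr addrC EFinD.
rewrite ge0_integralD; last 5 first.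
- exact: measurableT.
- by move=> z _; rewrite lee_fin pS0.
- by apply/measurable_EFinP; exact: mpS.
- by move=> z _; rewrite lee_fin p00.
- by apply/measurable_EFinP; exact: mp0.
have imf : (gauss1 c \x gauss_rV c n)%E.-integrable setT (EFin \o (f \o @cons_rV R n)).
  exact: (@integrable_bounded_prob _ _ _ (gauss1 c \x gauss_rV c n)%E) fcK.
have mF : measurable_fun setT
    (fun x => \int[gauss_rV c n]_y (f \o @cons_rV R n) (x, y)).
  by apply: measurableT_comp => //; exact: measurable_fubini_F imf.
have mG : measurable_fun setT
    (fun y => \int[gauss1 c]_x (f \o @cons_rV R n) (x, y)).
  by apply: measurableT_comp => //; exact: measurable_fubini_G imf.
apply: leeD.
  apply: ge0_le_integral_prod1 => //.
  - apply/measurable_EFinP; apply: measurable_funX; apply: measurable_funB => //.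
    exact: (measurableT_comp mF).
  - by apply/measurable_EFinP; exact: mpS.
  - by move=> z; rewrite lee_fin sqr_ge0.
  - by move=> x; apply: (IH _ _ (C1_rV_slice2 fp x)) => y; exact: fK.
apply: ge0_le_integral_prod2 => //.
- apply/measurable_EFinP; apply: measurable_funX; apply: measurable_funB => //.
  exact: (measurableT_comp mG).
- by apply/measurable_EFinP; exact: mp0.
- by move=> z; rewrite lee_fin sqr_ge0.
- move=> y /=.
  have dfy (x : R) := is_derive_slice1 fp x y.
  have cfy := @continuous_slice1 _ _ _ _ fp y.
  have mfy : measurable_fun setT (fun x : R => f (cons_rV (x, y))).
    by apply: continuous_measurable_fun; exact: is_derive_continuous dfy.
  apply: le_trans (@integral_sqr_mean_le _ _ _ (gauss1 c) _ K
    (f (cons_rV (0, y))) mfy (fun x => fK _)) _.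
  apply: le_trans (gauss1_poincare c0 dfy cfy) _.
  rewrite -ge0_integralZl//.
  + apply/measurable_EFinP; apply: measurable_funX.
    exact: continuous_measurable_fun.
  + by move=> x _; rewrite lee_fin sqr_ge0.
  + by rewrite lee_fin ltW.
Qed.

(** In [gauss1_moment_le] the mixed term is split by [x * F' <= lam / 2 * x^2 + F'^2 / (2 * lam)],
    and the [x^2] part is integrated exactly. *)
Lemma gauss1_moment (lam : R) (F F' : R -> R) : 0 < lam ->
  (forall x : R, is_derive x 1 F (F' x)) -> continuous F' ->
  (forall x, 0 <= F x) ->
  (\int[gauss1 c]_x (F x * x ^+ 2)%:E <=
   \int[gauss1 c]_x (kap * F x + kap ^+ 2 * lam / 2
                     + kap / (2 * lam) * F' x ^+ 2)%:E)%E.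
Proof.
move=> lam0 dF cF' F0.
have mF : measurable_fun setT (fun x => kap * F x).
  apply: measurable_funM => //; apply: continuous_measurable_fun.
  exact: is_derive_continuous dF.
have mF' : measurable_fun setT (fun x => kap / (2 * lam) * F' x ^+ 2).
  apply: measurable_funM => //; apply: measurable_funX.
  exact: continuous_measurable_fun.
have m2 : measurable_fun setT (fun x : R => kap * lam / 2 * x ^+ 2).
  by apply: measurable_funM => //; exact: measurable_funX.
have kF0 x : 0 <= kap * F x by rewrite mulr_ge0 ?(ltW kap0).
have kF'0 x : 0 <= kap / (2 * lam) * F' x ^+ 2.
  by rewrite mulr_ge0 ?sqr_ge0// divr_ge0 ?(ltW kap0)// mulr_ge0 ?(ltW lam0).
have kl0 : 0 <= kap * lam / 2 by rewrite divr_ge0// mulr_ge0 ?(ltW kap0) ?(ltW lam0).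
apply: le_trans (@gauss1_moment_le _ c F F' c0 dF cF'
  (fun x => (kap * F x + kap / (2 * lam) * F' x ^+ 2) + kap * lam / 2 * x ^+ 2) _ F0 _ _) _.
- by apply: measurable_funD => //; exact: measurable_funD.
- by move=> x; rewrite addr_ge0 ?addr_ge0// mulr_ge0 ?sqr_ge0.
- move=> x; rewrite -/kap -subr_ge0.
  rewrite (_ : _ - _ = kap / (2 * lam) * (F' x - lam * x) ^+ 2); last first.
    by field; rewrite gt_eqF.
  by rewrite mulr_ge0 ?sqr_ge0// divr_ge0 ?(ltW kap0)// mulr_ge0 ?(ltW lam0).
under eq_integral do rewrite EFinD.
rewrite ge0_integralD//; last 4 first.
- by move=> x _; rewrite lee_fin addr_ge0.
- by apply/measurable_EFinP; exact: measurable_funD.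
- by move=> x _; rewrite lee_fin mulr_ge0 ?sqr_ge0.
- exact/measurable_EFinP.
under [X in (_ + X <= _)%E]eq_integral do rewrite EFinM.
rewrite ge0_integralZl//; last 2 first.
- by apply/measurable_EFinP; exact: measurable_funX.
- by move=> x _; rewrite lee_fin sqr_ge0.
rewrite gauss1_second_moment//.
under [leRHS]eq_integral do rewrite addrAC EFinD.
rewrite ge0_integralD; last 5 first.
- exact: measurableT.
- by move=> x _; rewrite lee_fin addr_ge0.
- by apply/measurable_EFinP; exact: measurable_funD.
- by move=> x _; rewrite lee_fin mulr_ge0// mulr_ge0 ?sqr_ge0 ?(ltW lam0).
- exact: measurable_cst.
rewrite integral_prob_cst leeD2l// -EFinM lee_fin -/kap.
by rewrite le_eqVlt; apply/orP; left; apply/eqP; ring.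
Qed.

(* Linear in the gradient term, so that it tensorizes by mere addition;
   optimizing over lam recovers Cauchy-Schwarz. *)
Lemma gauss_rV_moment n (lam : R) (f : 'rV[R]_n -> R) p : 0 < lam ->
  C1_rV f p -> (forall x, 0 <= f x) ->
  (\int[gauss_rV c n]_x (f x * sqnorm x)%:E <=
   \int[gauss_rV c n]_x (n%:R * (kap * f x + kap ^+ 2 * lam / 2)
       + kap / (2 * lam) * \sum_i p i x ^+ 2)%:E)%E.
Proof.
move=> lam0; elim: n f p => [|n IH] f p fp f0.
  rewrite integral0_eq; last by move=> x _; rewrite /sqnorm big_ord0 mulr0.
  by apply: integral_ge0 => x _; rewrite big_ord0 mul0r mulr0 addr0.
have mf := measurable_C1 fp.
have mfc : measurable_fun setT (f \o @cons_rV R n).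
  by apply: measurableT_comp => //; exact: measurable_cons_rV.
have mp0 : measurable_fun setT (fun z => p 0 (cons_rV z) ^+ 2).
  by apply: (measurableT_comp (measurable_C1_sqr 0 fp)); exact: measurable_cons_rV.
have mpS : measurable_fun setT
    (fun z => \sum_(j < n) p (lift 0 j) (cons_rV z) ^+ 2).
  apply: (@measurable_sum _ _ _ _ _ _ (fun j z => p (lift 0 j) (cons_rV z) ^+ 2)) => j.
  apply: (measurableT_comp (measurable_C1_sqr (lift 0 j) fp)).
  exact: measurable_cons_rV.
have kl0 : 0 <= kap ^+ 2 * lam / 2.
  by rewrite divr_ge0// mulr_ge0 ?sqr_ge0// ltW.
have kl0' : 0 <= kap / (2 * lam) by rewrite divr_ge0 ?(ltW kap0)// mulr_ge0 ?(ltW lam0).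
pose H0 z := kap * f (cons_rV z) + kap ^+ 2 * lam / 2
    + kap / (2 * lam) * p 0 (cons_rV z) ^+ 2.
pose HS z := n%:R * (kap * f (cons_rV z) + kap ^+ 2 * lam / 2)
    + kap / (2 * lam) * \sum_(j < n) p (lift 0 j) (cons_rV z) ^+ 2.
have H0_ge0 z : 0 <= H0 z.
  apply: addr_ge0; last by rewrite mulr_ge0// sqr_ge0.
  by rewrite addr_ge0// mulr_ge0 ?(ltW kap0).
have HS_ge0 z : 0 <= HS z.
  apply: addr_ge0; last by rewrite mulr_ge0// sumr_ge0// => j _; exact: sqr_ge0.
  by rewrite mulr_ge0// addr_ge0// mulr_ge0 ?(ltW kap0).
have mH : measurable_fun setT (fun z => kap * f (cons_rV z) + kap ^+ 2 * lam / 2).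
  by apply: measurable_funD => //; exact: measurable_funM.
have mH0 : measurable_fun setT H0.
  by apply: measurable_funD => //; exact: measurable_funM.
have mHS : measurable_fun setT HS.
  by apply: measurable_funD => //; exact: measurable_funM.
rewrite !ge0_integral_gauss_rV_prod; last 4 first.
- apply/measurable_EFinP; apply: measurable_funD.
    apply: measurable_funM => //; apply: measurable_funD => //.
    exact: measurable_funM.
  by apply: measurable_funM => //; exact: measurable_C1_grad fp.
- move=> x; rewrite lee_fin; apply: addr_ge0.
    by rewrite mulr_ge0// addr_ge0// mulr_ge0 ?(ltW kap0).
  by rewrite mulr_ge0// sumr_ge0// => j _; exact: sqr_ge0.
- apply/measurable_EFinP; apply: measurable_funM => //.
  exact: measurable_sqnorm.
- by move=> x; rewrite lee_fin mulr_ge0// sqnorm_ge0.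
rewrite (_ : (fun z => (_ + _ * \sum_(i < n.+1) _)%:E) =
    (fun z => (H0 z)%:E + (HS z)%:E)%E); last first.
  apply/funext => z; rewrite -EFinD; congr EFin.
  by rewrite big_ord_recl /H0 /HS -[n.+1%:R]natr1; ring.
have mx2 : measurable_fun setT (fun z : measurableTypeR R * 'rV[R]_n =>
    (f (cons_rV z) * z.1 ^+ 2)%:E).
  apply/measurable_EFinP; apply: measurable_funM => //.
  exact: measurable_funX.
have my2 : measurable_fun setT (fun z : measurableTypeR R * 'rV[R]_n =>
    (f (cons_rV z) * sqnorm z.2)%:E).
  apply/measurable_EFinP; apply: measurable_funM => //.
  exact: (measurableT_comp (@measurable_sqnorm R n)).
rewrite (_ : (fun z => (f (cons_rV z) * sqnorm (cons_rV z))%:E) =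
    (fun z => (f (cons_rV z) * z.1 ^+ 2)%:E + (f (cons_rV z) * sqnorm z.2)%:E)%E); last first.
  by apply/funext => -[x y]; rewrite sqnorm_cons mulrDr EFinD.
rewrite ge0_integralD; last 5 first.
- exact: measurableT.
- by move=> z _; rewrite lee_fin mulr_ge0 ?sqr_ge0.
- exact: mx2.
- by move=> z _; rewrite lee_fin mulr_ge0 ?sqnorm_ge0.
- exact: my2.
rewrite ge0_integralD; last 5 first.
- exact: measurableT.
- by move=> z _; rewrite lee_fin.
- by apply/measurable_EFinP; exact: mH0.
- by move=> z _; rewrite lee_fin.
- by apply/measurable_EFinP; exact: mHS.
apply: leeD.
- apply: ge0_le_integral_prod2 => //.
  + exact/measurable_EFinP.
  + by move=> z; rewrite lee_fin mulr_ge0 ?sqr_ge0.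
  + move=> y; apply: gauss1_moment => //.
    * by move=> x; exact: is_derive_slice1 fp _ _.
    * exact: (@continuous_slice1 _ _ _ _ fp y).
- apply: ge0_le_integral_prod1 => //.
  + exact/measurable_EFinP.
  + by move=> z; rewrite lee_fin mulr_ge0 ?sqnorm_ge0.
  + by move=> x; apply: IH (C1_rV_slice2 fp x) _ => y; exact: f0.
Qed.

End gauss_rV_inequalities.

(** The infimum of [A * lam + B / lam] over [lam > 0] is [2 * sqrt (A * B)]. *)
Lemma sqr_le_of_amgm (R : realFieldType) (A B u : R) : 0 <= A -> 0 <= B ->
  (forall lam, 0 < lam -> `|u| <= A * lam + B / lam) -> u ^+ 2 <= 4 * A * B.
Proof.
move=> A0 B0 H; rewrite -real_normK ?num_real//.
have [->|u0] := eqVneq u 0; first by rewrite normr0 expr0n/= !mulr_ge0.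
have {u0} : 0 < `|u| by rewrite normr_gt0.
move: (`|u|) H => {}u H u0; rewrite le_eqVlt in A0.
case/predU1P : A0 => [A0|A0].
  (* For [A = 0] a large [lam] forces [u = 0]; this one already contradicts [u > 0]. *)
  have l0 : 0 < 2 * (B + 1) / u by rewrite divr_gt0// mulr_gt0// ltr_wpDl.
  have := H _ l0; rewrite -A0 mul0r add0r invf_div mulrA.
  rewrite ler_pdivlMr ?mulr_gt0 ?ltr_wpDl// => Hu.
  have h : 0 < u * (B + 2) by rewrite mulr_gt0// ltr_wpDl.
  lra.
(* In the equality case [u = 2 * sqrt (A * B)] this is the optimal [lam = sqrt (B / A)], written
   without a root. *)
have l0 : 0 < u / (2 * A) by rewrite divr_gt0// mulr_gt0.
have := H _ l0; rewrite invf_div (_ : A * _ = u / 2); last by field; rewrite gt_eqF.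
rewrite -lerBlDl (_ : u - u / 2 = u / 2); last by field.
by rewrite mulrA ler_pdivlMr// => ?; nra.
Qed.

(** * Covariance of a bounded function with the squared norm *)

Section gauss_rV_cov.
Context {R : realType}.
Variable c : R.
Hypothesis c0 : 0 < c.
Let kap : R := (2 * c)^-1.
Let kap0 : 0 < kap. Proof. by rewrite invr_gt0 mulr_gt0. Qed.

Lemma gauss_rV_second_moment n :
  (\int[gauss_rV c n]_x (sqnorm x)%:E = (n%:R * kap)%:E)%E.
Proof.
elim: n => [|n IH].
  by rewrite integral0_eq ?mul0r// => x _; rewrite /sqnorm big_ord0.
rewrite ge0_integral_gauss_rVS//; last 2 first.
- by apply/measurable_EFinP; exact: measurable_sqnorm.
- by move=> x; rewrite lee_fin sqnorm_ge0.
rewrite (_ : (fun x => _) = (fun x : R => (x ^+ 2)%:E + (n%:R * kap)%:E)%E).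
  rewrite ge0_integralD//; last 3 first.
  - by move=> x _; rewrite lee_fin sqr_ge0.
  - by apply/measurable_EFinP; exact: measurable_funX.
  - by move=> x _; rewrite lee_fin mulr_ge0 ?(ltW kap0).
  rewrite gauss1_second_moment// integral_prob_cst -EFinD -/kap.
  by rewrite -[n.+1%:R]natr1 mulrDl mul1r addrC.
apply/funext => x; under eq_integral do rewrite sqnorm_cons EFinD.
rewrite ge0_integralD//; last 3 first.
- by move=> y _; rewrite lee_fin sqr_ge0.
- by move=> y _; rewrite lee_fin sqnorm_ge0.
- by apply/measurable_EFinP; exact: measurable_sqnorm.
by rewrite IH integral_prob_cst.
Qed.

Lemma integrable_gauss_rV_sqnorm n (f : 'rV[R]_n -> R) (K : R) :
  measurable_fun setT f -> (forall x, `|f x| <= K) ->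
  (gauss_rV c n).-integrable setT (fun x => (f x * sqnorm x)%:E).
Proof.
move=> mf fK; have isq : (gauss_rV c n).-integrable setT (fun x => (sqnorm x)%:E).
  apply/integrableP; split; first by apply/measurable_EFinP; exact: measurable_sqnorm.
  under eq_integral do rewrite gee0_abs ?lee_fin ?sqnorm_ge0//.
  by rewrite gauss_rV_second_moment ltry.
apply: (@le_integrable _ _ _ _ _ measurableT _ (fun x => (K * sqnorm x)%:E)) => //.
- by apply/measurable_EFinP; apply: measurable_funM => //; exact: measurable_sqnorm.
- move=> x _; rewrite lee_fin !normrM ler_wpM2r// (le_trans (fK x))//.
  exact: ler_norm.
- by under eq_fun do rewrite EFinM; exact: integrableZl.
Qed.

Lemma C1_rV_cstB n (f : 'rV[R]_n -> R) p (K : R) :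
  C1_rV f p -> C1_rV (fun x => K - f x) (fun i x => - p i x).
Proof.
case=> cf cp dfp; split.
- by move=> x; apply: continuousB; [exact: cst_continuous|exact: cf].
- by move=> i x; apply: continuousN; exact: cp.
- move=> i x; have dfx := dfp i x.
  by apply: is_derive_eq; rewrite add0r.
Qed.

(** [gauss_rV_moment] moved to the reals, where the mean term can be subtracted, for a finite
    gradient integral [r]. *)
Let gauss_rV_moment_real n (lam r K : R) (f : 'rV[R]_n -> R) p : 0 < lam ->
  C1_rV f p -> (forall x, 0 <= f x <= K) ->
  (\int[gauss_rV c n]_x (\sum_i p i x ^+ 2)%:E = r%:E)%E ->
  \int[gauss_rV c n]_x (f x * sqnorm x) - n%:R * kap * \int[gauss_rV c n]_x f x <=
  n%:R * kap ^+ 2 / 2 * lam + kap * r / 2 / lam.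
Proof.
move=> lam0 fp fK gr.
have mf := measurable_C1 fp.
have f0 x : 0 <= f x by have /andP[] := fK x.
have fK' x : `|f x| <= K by rewrite ger0_norm//; have /andP[] := fK x.
have := gauss_rV_moment c0 lam0 fp f0; rewrite -/kap.
under [leRHS]eq_integral do rewrite EFinD.
have kl0' : 0 <= kap / (2 * lam) by rewrite divr_ge0 ?(ltW kap0)// mulr_ge0 ?(ltW lam0).
have kl0 : 0 <= kap ^+ 2 * lam / 2.
  by rewrite divr_ge0// mulr_ge0 ?sqr_ge0// ltW.
have mg := measurable_C1_grad fp.
have g0 x : 0 <= \sum_i p i x ^+ 2 by rewrite sumr_ge0// => i _; exact: sqr_ge0.
rewrite ge0_integralD; last 5 first.
- exact: measurableT.
- move=> x _; rewrite lee_fin mulr_ge0// addr_ge0// mulr_ge0 ?(ltW kap0)//.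
- apply/measurable_EFinP; apply: measurable_funM => //.
  by apply: measurable_funD => //; exact: measurable_funM.
- by move=> x _; rewrite lee_fin mulr_ge0.
- by apply/measurable_EFinP; exact: measurable_funM.
under [X in (_ <= _ + X)%E]eq_integral do rewrite EFinM.
rewrite ge0_integralZl//; last 2 first.
- exact/measurable_EFinP.
- by move=> x _; rewrite lee_fin.
have -> : (\int[gauss_rV c n]_x (n%:R * (kap * f x + kap ^+ 2 * lam / 2))%:E =
    (n%:R * kap * \int[gauss_rV c n]_x f x + n%:R * kap ^+ 2 / 2 * lam)%:E)%E.
  transitivity (\int[gauss_rV c n]_x
      ((n%:R * kap)%:E * (f x)%:E + (n%:R * (kap ^+ 2 * lam / 2))%:E)%E)%E.
    by apply: eq_integral => x _; rewrite -EFinM -EFinD; congr EFin; ring.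
  rewrite integralD//; last 2 first.
  - by apply: integrableZl => //; exact: integrable_bounded_prob fK'.
  - by apply: (@integrable_bounded_prob _ _ _ (gauss_rV c n) _ `|n%:R * (kap ^+ 2 * lam / 2)|).
  rewrite integral_prob_cst integralZl//; last exact: integrable_bounded_prob fK'.
  rewrite -(EFin_Rintegral _ mf fK') -EFinM -EFinD; congr EFin; ring.
rewrite gr.
have -> : (\int[gauss_rV c n]_x (f x * sqnorm x)%:E =
    (\int[gauss_rV c n]_x (f x * sqnorm x))%:E)%E.
  rewrite /Rintegral fineK//; apply: integrable_fin_num => //.
  exact: integrable_gauss_rV_sqnorm fK'.
rewrite -EFinM -EFinD lee_fin -addrA -lerBlDl => /le_trans; apply.
by rewrite le_eqVlt; apply/orP; left; apply/eqP; field; rewrite gt_eqF.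
Qed.

(** The square is that of a covariance, as [n * kap] is the mean of [sqnorm]. [gauss_rV_moment_real]
    bounds the covariance from above and, applied to [K - f], from below; [sqr_le_of_amgm] then
    optimizes over [lam]. *)
Lemma gauss_rV_cov_sqnorm n (f : 'rV[R]_n -> R) p (K : R) :
  C1_rV f p -> (forall x, 0 <= f x <= K) ->
  (((\int[gauss_rV c n]_x (f x * sqnorm x)
      - n%:R * kap * \int[gauss_rV c n]_x f x) ^+ 2)%:E
   <= (n%:R * kap ^+ 3)%:E * \int[gauss_rV c n]_x (\sum_i p i x ^+ 2)%:E)%E.
Proof.
move=> fp fK; have mf := measurable_C1 fp.
have fK' x : `|f x| <= K by have /andP[f0 fk] := fK x; rewrite ger0_norm.
have g0 x : 0 <= \sum_i p i x ^+ 2 by rewrite sumr_ge0// => i _; exact: sqr_ge0.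
have G0 : (0 <= \int[gauss_rV c n]_x (\sum_i p i x ^+ 2)%:E)%E.
  by apply: integral_ge0 => x _; rewrite lee_fin.
case E : (\int[gauss_rV c n]_x (\sum_i p i x ^+ 2)%:E)%E G0 => [r| |]// r0.
- rewrite -EFinM lee_fin.
  have := @sqr_le_of_amgm R (n%:R * kap ^+ 2 / 2) (kap * r / 2).
  rewrite (_ : 4 * _ * _ = n%:R * kap ^+ 3 * r); last by field.
  apply.
  + by rewrite divr_ge0// mulr_ge0// sqr_ge0.
  + by rewrite divr_ge0// mulr_ge0// ltW.
  move=> lam lam0; rewrite ler_norml; apply/andP; split; last first.
    exact: gauss_rV_moment_real fp fK E.
  have fK2 x : 0 <= K - f x <= K by have /andP[? ?] := fK x; apply/andP; split; lra.
  have E' : (\int[gauss_rV c n]_x (\sum_i (- p i x) ^+ 2)%:E = r%:E)%E.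
    by rewrite -E; apply: eq_integral => x _; under eq_bigr do rewrite sqrrN.
  have := gauss_rV_moment_real lam0 (C1_rV_cstB K fp) fK2 E'.
  have ifs := integrable_gauss_rV_sqnorm mf fK'.
  have iKs := @integrable_gauss_rV_sqnorm n _ _ (measurable_cst K) (fun=> lexx `|K|).
  have e1 : \int[gauss_rV c n]_x ((K - f x) * sqnorm x) =
      K * (n%:R * kap) - \int[gauss_rV c n]_x (f x * sqnorm x).
    under eq_Rintegral do rewrite mulrBl.
    rewrite RintegralB//; congr (_ - _); rewrite RintegralZl//.
      by rewrite /Rintegral gauss_rV_second_moment.
    have := @integrable_gauss_rV_sqnorm n (fun=> 1) 1 (@measurable_cst _ _ _ _ _ _)
      (fun=> ltac:(by rewrite normr1)).
    by under eq_fun do rewrite mul1r.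
  have e2 : \int[gauss_rV c n]_x (K - f x) = K - \int[gauss_rV c n]_x f x.
    rewrite RintegralB ?Rintegral_prob_cst//.
    - exact: (@integrable_bounded_prob _ _ _ _ (fun=> K) `|K|).
    - exact: integrable_bounded_prob fK'.
  rewrite e1 e2 => h; rewrite lerNl; apply: le_trans h.
  by rewrite le_eqVlt; apply/orP; left; apply/eqP; ring.
(* Infinite gradient integral: impossible for [n = 0], where the gradient is an empty sum; otherwise
   the positive coefficient makes the right side infinite. *)
- case: n f p fp fK mf fK' g0 E => [|n] f p fp fK mf fK' g0 E.
    by move: E; rewrite integral0_eq// => x _; rewrite big_ord0.
  by rewrite gt0_muley ?leey// lte_fin mulr_gt0// exprn_gt0.
Qed.

End gauss_rV_cov.

(** * Dependence of the Gaussian mean on the scale *)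

Section gauss_mean.
Context {R : realType} (n : nat).
Notation leb := (lebesgue_rV R n).

Lemma integrable_gauss_rV_pdf (c : R) (h : 'rV[R]_n -> R) : 0 < c ->
  (gauss_rV c n).-integrable setT (EFin \o h) ->
  leb.-integrable setT (fun x => (h x * gauss_rV_pdf c x)%:E).
Proof.
move=> c0 /integrableP[/measurable_EFinP mh hoo]; apply/integrableP; split.
  by apply/measurable_EFinP; apply: measurable_funM => //; exact: measurable_gauss_rV_pdf.
rewrite ge0_integral_gauss_rV// in hoo; last first.
  by apply: measurableT_comp => //; exact/measurable_EFinP.
rewrite (le_lt_trans _ hoo)// le_eqVlt; apply/orP; left; apply/eqP.
apply: eq_integral => x _; rewrite EFinM abseM; congr (_ * _)%E.
by rewrite gee0_abs// lee_fin gauss_rV_pdf_ge0.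
Qed.

Lemma ge0_Rintegral_gauss_rV (c : R) (h : 'rV[R]_n -> R) : 0 < c ->
  measurable_fun setT h -> (forall x, 0 <= h x) ->
  \int[gauss_rV c n]_x h x = \int[leb]_x (h x * gauss_rV_pdf c x).
Proof.
move=> c0 mh h0; rewrite /Rintegral; congr fine.
rewrite ge0_integral_gauss_rV//; first exact/measurable_EFinP.
Qed.

Lemma gauss_rV_pdf_expR (tau : R) (x : 'rV[R]_n) :
  gauss_rV_pdf (expR (- tau)) x =
  Num.sqrt pi^-1 ^+ n * expR (- (n%:R / 2 * tau) - expR (- tau) * sqnorm x).
Proof.
rewrite /gauss_rV_pdf sqrtrM ?expR_ge0// exprMn expRD mulrA; congr (_ * _).
rewrite mulrC; congr (_ * _).
have -> : Num.sqrt (expR (- tau)) = expR (- tau / 2).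
  rewrite {1}(_ : - tau = - tau / 2 + - tau / 2); last by field.
  by rewrite expRD -expr2 sqrtr_sqr ger0_norm ?expR_ge0.
by rewrite -expRM_natl; congr expR; field.
Qed.

Variables (f : 'rV[R]_n -> R) (K : R).
Hypothesis mf : measurable_fun setT f.
Hypothesis fK : forall x, 0 <= f x <= K.

Let fK' x : `|f x| <= K.
Proof. by have /andP[? ?] := fK x; rewrite ger0_norm. Qed.

Definition gauss_mean (tau : R) : R := \int[gauss_rV (expR (- tau)) n]_x f x.

Let q (tau : R) (x : 'rV[R]_n) := gauss_rV_pdf (expR (- tau)) x.

(** The factor between [f] and [q] is the logarithmic derivative of the density in [tau]. *)
Definition gauss_mean_deriv (tau : R) : R :=
  \int[leb]_x (f x * (expR (- tau) * sqnorm x - n%:R / 2) * q tau x).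

Let is_derive_q (tau : R) x :
  is_derive tau 1 (fun t => q t x) ((expR (- tau) * sqnorm x - n%:R / 2) * q tau x).
Proof.
rewrite (_ : (fun t => q t x) = (fun t =>
  Num.sqrt pi^-1 ^+ n * expR (- (n%:R / 2 * t) - expR (- t) * sqnorm x))); last first.
  by apply/funext => t; exact: gauss_rV_pdf_expR.
rewrite /q gauss_rV_pdf_expR; apply: is_derive_eq.
by rewrite /GRing.scale/=; ring.
Qed.

(** Integrable majorant of the [tau]-derivative of [f * q] for [tau] within 1 of [t1]. The factor
    [exp n] pays for moving the normalization [exp (- n tau / 2)] to [t1 + 1], over a distance of at
    most 2. *)
Let G (t1 : R) x : R :=
  (K * expR n%:R * (expR (- (t1 - 1)) * sqnorm x + n%:R / 2)) * q (t1 + 1) x.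

Let K0 : 0 <= K.
Proof. by have /andP[f0 /(le_trans f0)] := fK 0. Qed.

Let w_ge0 (t1 : R) (x : 'rV[R]_n) : 0 <= expR (- (t1 - 1)) * sqnorm x + n%:R / 2.
Proof. by rewrite addr_ge0 ?divr_ge0// mulr_ge0 ?expR_ge0 ?sqnorm_ge0. Qed.

Let G_ge0 t1 x : 0 <= G t1 x.
Proof. by rewrite mulr_ge0 ?gauss_rV_pdf_ge0// !mulr_ge0// ?expR_ge0. Qed.

Let integrable_G t1 : leb.-integrable setT (EFin \o G t1).
Proof.
apply: integrable_gauss_rV_pdf; first exact: expR_gt0.
rewrite (_ : _ \o _ = (fun x => ((K * expR n%:R * expR (- (t1 - 1))) * sqnorm x)%:E +
    (K * expR n%:R * (n%:R / 2))%:E)%E); last first.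
  by apply/funext => x /=; rewrite -EFinD mulrDr mulrA.
apply: integrableD => //.
  apply: (@integrable_gauss_rV_sqnorm _ _ _ _ (fun=> K * expR n%:R * expR (- (t1 - 1)))
    `|K * expR n%:R * expR (- (t1 - 1))|) => //.
  exact: expR_gt0.
exact: (@integrable_bounded_prob _ _ _ _ (fun=> K * expR n%:R * (n%:R / 2))
    `|K * expR n%:R * (n%:R / 2)|).
Qed.

Let deriv_le_G t1 t x : t \in `]t1 - 1, t1 + 1[ ->
  `|f x * (expR (- t) * sqnorm x - n%:R / 2) * q t x| <= G t1 x.
Proof.
rewrite in_itv/= => /andP[lt1 lt2].
have qq : q t x <= expR n%:R * q (t1 + 1) x.
  rewrite /q !gauss_rV_pdf_expR mulrCA ler_wpM2l ?exprn_ge0// -expRD ler_expR addrA lerB//.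
    have n0 : 0 <= n%:R / 2 :> R by rewrite divr_ge0.
    rewrite (_ : n%:R - _ = - (n%:R / 2 * (t1 - 1))); last by field.
    by rewrite lerN2 ler_wpM2l// ltW.
  by rewrite ler_wpM2r ?sqnorm_ge0// ler_expR lerN2 ltW.
rewrite normrM [X in _ * X]ger0_norm ?gauss_rV_pdf_ge0// /G.
apply: (@le_trans _ _ ((K * (expR (- (t1 - 1)) * sqnorm x + n%:R / 2)) *
    (expR n%:R * q (t1 + 1) x))); last first.
  by rewrite le_eqVlt; apply/orP; left; apply/eqP; ring.
apply: ler_pM => //; first exact: gauss_rV_pdf_ge0.
rewrite normrM; apply: ler_pM => //.
apply: (le_trans (ler_normB _ _)); apply: lerD; last by rewrite ger0_norm.
rewrite ger0_norm; last by rewrite mulr_ge0 ?expR_ge0 ?sqnorm_ge0.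
by rewrite ler_wpM2r ?sqnorm_ge0// ler_expR lerN2 ltW.
Qed.

Let integrable_fq t : leb.-integrable setT (fun x => (f x * q t x)%:E).
Proof.
apply: integrable_gauss_rV_pdf; first exact: expR_gt0.
exact: integrable_bounded_prob fK'.
Qed.

Let measurable_deriv t : measurable_fun setT
  (fun x => f x * (expR (- t) * sqnorm x - n%:R / 2) * q t x).
Proof.
apply: measurable_funM; last exact: measurable_gauss_rV_pdf.
apply: measurable_funM => //; apply: measurable_funB => //.
by apply: measurable_funM => //; exact: measurable_sqnorm.
Qed.

Lemma gauss_meanE : gauss_mean = fun t => \int[leb]_x (f x * q t x).
Proof.
apply/funext => t; rewrite /gauss_mean ge0_Rintegral_gauss_rV ?expR_gt0//.
by move=> x; have /andP[] := fK x.
Qed.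

Lemma is_derive_gauss_mean (t : R) : is_derive t 1 gauss_mean (gauss_mean_deriv t).
Proof.
have It : t \in `]t - 1, t + 1[ by rewrite in_itv/= ltrBlDr ltrDl ltr01.
have dfq (s : R) x : is_derive s 1 (fun s => f x * q s x)
    (f x * (expR (- s) * sqnorm x - n%:R / 2) * q s x).
  have dq := is_derive_q s x; apply: is_derive_eq.
  by rewrite /GRing.scale/=; ring.
have d1E s x : partial1of2 (fun s x => f x * q s x) s x =
    f x * (expR (- s) * sqnorm x - n%:R / 2) * q s x.
  by rewrite partial1of2E; have := dfq s x => dfx; rewrite derive_val.
rewrite gauss_meanE; apply: DeriveDef.
  apply: (@derivable_under_integral _ _ _ leb (fun s x => f x * q s x) setT
    measurableT t (t - 1) (t + 1) It _ _ (G t) (G_ge0 t) (integrable_G t)).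
  - by move=> s _; exact: integrable_fq.
  - by move=> s x _ _; have := dfq s x => dfx; exact: ex_derive.
  - by move=> s x Is _; rewrite d1E; exact: deriv_le_G.
rewrite -derive1E.
rewrite (@differentiation_under_integral _ _ _ leb (fun s x => f x * q s x) setT
    measurableT t (t - 1) (t + 1) It _ _ (G t) (G_ge0 t) (integrable_G t)).
- by apply: eq_Rintegral => x _; rewrite d1E.
- by move=> s _; exact: integrable_fq.
- by move=> s x _ _; have := dfq s x => dfx; exact: ex_derive.
- by move=> s x Is _; rewrite d1E; exact: deriv_le_G.
Qed.

Lemma continuous_gauss_mean_deriv : continuous gauss_mean_deriv.
Proof.
move=> t; have It : t \in `]t - 1, t + 1[ by rewrite in_itv/= ltrBlDr ltrDl ltr01.
apply: (@continuity_under_integral _ _ _ leb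
  (fun s x => f x * (expR (- s) * sqnorm x - n%:R / 2) * q s x) setT measurableT
  (t - 1) (t + 1) _ _ (G t) (integrable_G t)) => //.
- move=> s Is; apply: le_integrable (integrable_G t) => //.
    exact/measurable_EFinP.
  move=> x _; rewrite lee_fin [leRHS]ger0_norm ?G_ge0//; exact: deriv_le_G.
- apply: aeW => x _ s _.
  have cq : {for s, continuous (fun s => q s x)}.
    apply: differentiable_continuous; apply/derivable1_diffP.
    by have dq := is_derive_q s x; exact: ex_derive.
  apply: cvgM; last exact: cq.
  apply: cvgM; first exact: cvg_cst.
  apply: cvgB; last exact: cvg_cst.
  apply: cvgM; last exact: cvg_cst.
  apply: continuous_comp; last exact: continuous_expR.
  by apply: (@cvgN _ R^o); exact: cvg_id.
- by move=> s Is; apply: aeW => x _; exact: deriv_le_G.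
- by rewrite inE.
Qed.

(** Identifies the derivative with [exp (- t)] times the covariance of [f] and [sqnorm], which
    [gauss_rV_cov_sqnorm] controls. *)
Lemma gauss_mean_derivE (t : R) : gauss_mean_deriv t =
  expR (- t) * (\int[gauss_rV (expR (- t)) n]_x (f x * sqnorm x)
    - n%:R * (2 * expR (- t))^-1 * \int[gauss_rV (expR (- t)) n]_x f x).
Proof.
have f0 x : 0 <= f x by have /andP[] := fK x.
have c0 := expR_gt0 (- t).
have mfs : measurable_fun setT (fun x => f x * sqnorm x).
  by apply: measurable_funM => //; exact: measurable_sqnorm.
rewrite !ge0_Rintegral_gauss_rV//; last by move=> x; rewrite mulr_ge0 ?sqnorm_ge0.
have i1 := integrable_gauss_rV_pdf c0 (integrable_gauss_rV_sqnorm c0 mf fK').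
have i2 := integrable_fq t.
rewrite mulrBr mulrA (_ : expR (- t) * (n%:R * _) = n%:R / 2); last first.
  by field; rewrite gt_eqF.
rewrite -!RintegralZl// -RintegralB//; last 2 first.
- exact: (integrableZl measurableT (expR (- t)) i1).
- exact: (integrableZl measurableT (n%:R / 2) i2).
by apply: eq_Rintegral => x _; rewrite /q; ring.
Qed.

(** With [c = exp (- t)] the constant is [c^2 * n / (2 * c)^3 = n / (8 * c)]. *)
Lemma sqr_gauss_mean_deriv_le p (t : R) : C1_rV f p ->
  ((gauss_mean_deriv t ^+ 2)%:E <= (n%:R / 8 * expR t)%:E *
    \int[gauss_rV (expR (- t)) n]_x (\sum_i p i x ^+ 2)%:E)%E.
Proof.
move=> fp; have c0 := expR_gt0 (- t).
rewrite gauss_mean_derivE exprMn EFinM.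
apply: le_trans (lee_wpmul2l _ (gauss_rV_cov_sqnorm c0 fp fK)) _.
  by rewrite lee_fin sqr_ge0.
rewrite muleA -EFinM le_eqVlt; apply/orP; left; apply/eqP; congr (_%:E * _)%E.
by rewrite expRN; field; rewrite gt_eqF// expR_gt0.
Qed.

End gauss_mean.

(** * The Gamma weight *)

Section gamma_hardy.
Context {R : realType}.
Notation mu := (@lebesgue_measure R).
Implicit Types t : R.

(* The Gamma(a) density t^(a - 1) e^(- t) in the variable tau = - ln t. *)
Definition gamma_weight (a t : R) : R := expR (- (a * t) - expR (- t)).

Lemma gamma_weight_ge0 a t : 0 <= gamma_weight a t.
Proof. exact: expR_ge0. Qed.

Lemma is_derive_gamma_weight a t :
  is_derive t 1 (gamma_weight a) ((expR (- t) - a) * gamma_weight a t).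
Proof.
by rewrite /gamma_weight; apply: is_derive_eq; rewrite /GRing.scale/=; ring.
Qed.

Lemma continuous_gamma_weight a : continuous (gamma_weight a).
Proof. exact: is_derive_continuous (is_derive_gamma_weight a). Qed.

Lemma measurable_gamma_weight a : measurable_fun setT (gamma_weight a).
Proof. by apply: continuous_measurable_fun; exact: continuous_gamma_weight. Qed.

Variables (a A B T : R) (m m' : R -> R) (g : R -> \bar R).
Hypotheses (B0 : 0 <= B).
Hypothesis dm : forall t : R, is_derive t 1 m (m' t).
Hypothesis cm' : continuous m'.
Hypothesis mg : measurable_fun setT g.
Hypothesis g0 : forall t, (0 <= g t)%E.
Hypothesis m'g : forall t, ((m' t ^+ 2)%:E <= (B * expR t)%:E * g t)%E.

Let om := gamma_weight a.

(* F^2 om <= 2 (F^2 h om)' + 4 (m' h)^2 om when h' + h (e^-t - a) >= 1. *)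
Lemma gamma_hardy_itv (p q t0 : R) (h h' : R -> R) : p <= q ->
  (forall t : R, is_derive t 1 h (h' t)) -> continuous h' ->
  {in `[p, q], forall t, 1 <= h' t + h t * (expR (- t) - a)} ->
  {in `[p, q], forall t, h t ^+ 2 <= A * expR (T - t)} ->
  0 <= (m p - m t0) ^+ 2 * h p -> (m q - m t0) ^+ 2 * h q <= 0 ->
  (\int[mu]_(t in `[p, q]) ((m t - m t0) ^+ 2 * om t)%:E <=
   \int[mu]_(t in `[p, q]) ((4 * B * A * expR T)%:E * (g t * (om t)%:E)))%E.
Proof.
move=> pq dh ch' h1 hA hp hq.
have cm := is_derive_continuous dm.
have ch := is_derive_continuous dh.
have com : continuous om by exact: continuous_gamma_weight.
pose F t := m t - m t0.
have cF : continuous F by move=> t; apply: cvgB; [exact: cm|exact: cvg_cst].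
have cF2 : continuous (fun t => F t ^+ 2).
  by move=> t; rewrite /GRing.exp/=; apply: cvgM; exact: cF.
pose G t := - 2 * (F t ^+ 2 * h t * om t).
pose G' t := - 2 * (2 * F t * m' t * h t + F t ^+ 2 * (h' t + h t * (expR (- t) - a))) * om t.
have cexpN : continuous (fun t => expR (- t)).
  move=> t; apply: continuous_comp; last exact: continuous_expR.
  by apply: (@cvgN _ R^o); exact: cvg_id.
have A0 : 0 <= A.
  have := hA p; rewrite in_itv/= lexx pq => /(_ isT).
  by move=> /(le_trans (sqr_ge0 _)); rewrite pmulr_lge0// expR_gt0.
have H := @integral_le_lyapunov R p q (fun t => F t ^+ 2 * om t) G G'
  (fun t => (4 * B * A * expR T)%:E * (g t * (om t)%:E))%E pq.
apply: le_trans (H _ _ _ _ _ _).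
- rewrite leeDl// lee_fin /G -mulrBr mulNr oppr_ge0 pmulr_rle0// subr_le0.
  apply: (@le_trans _ _ 0).
    by rewrite mulr_le0_ge0// gamma_weight_ge0.
  by rewrite mulr_ge0// gamma_weight_ge0.
- move=> t _; rewrite /G; have dmt := dm t; have dht := dh t.
  have dom : is_derive t 1 om _ := is_derive_gamma_weight a t.
  by apply: is_derive_eq; rewrite /G' /GRing.scale/= /F -/om; ring.
- move=> t _; apply: cvgM; last exact: com.
  apply: cvgM; first exact: cvg_cst.
  apply: cvgD.
    apply: cvgM; last exact: ch.
    apply: cvgM; last exact: cm'.
    by apply: cvgM; [exact: cvg_cst|exact: cF].
  apply: cvgM; first exact: cF2.
  apply: cvgD; first exact: ch'.
  apply: cvgM; first exact: ch.
  by apply: cvgB; [exact: cexpN|exact: cvg_cst].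
- by move=> t _; apply: cvgM; [exact: cF2|exact: com].
- apply: measurable_funTS; apply: measurable_funeM; apply: emeasurable_funM => //.
  by apply/measurable_EFinP; exact: measurable_gamma_weight.
- move=> t; rewrite mule_ge0 ?lee_fin ?mulr_ge0 ?expR_ge0// mule_ge0//.
  by rewrite lee_fin gamma_weight_ge0.
move=> t tpq.
apply: (@le_trans _ _ (4 * m' t ^+ 2 * (A * expR (T - t)) * om t)%:E).
  rewrite lee_fin /G' -mulrDl ler_wpM2r ?gamma_weight_ge0//.
  have := h1 t tpq; have := hA t tpq; move: (h' t + _) => u hA' u1.
  have f1 : F t ^+ 2 <= F t ^+ 2 * u by rewrite ler_peMr ?sqr_ge0.
  have f2 : 4 * m' t ^+ 2 * h t ^+ 2 <= 4 * m' t ^+ 2 * (A * expR (T - t)).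
    by rewrite ler_wpM2l// mulr_ge0 ?sqr_ge0.
  (* As [u >= 1], [F^2 - 4 F m' h - 2 F^2 u <= - F^2 - 4 F m' h = 4 (m' h)^2 - (F + 2 m' h)^2]. *)
  by have := sqr_ge0 (F t + 2 * m' t * h t); nra.
(* The [exp (T - t)] bounding [h^2] cancels the [exp t] of [m'g] up to [exp T]; this dictates the
   form of the bound on [h]. *)
rewrite (_ : (4 * m' t ^+ 2 * _ * om t)%:E =
    (4 * (A * expR (T - t)) * om t)%:E * (m' t ^+ 2)%:E)%E; last first.
  by rewrite -EFinM; congr EFin; ring.
apply: le_trans (lee_wpmul2l _ (m'g t)) _.
  by rewrite lee_fin !mulr_ge0 ?expR_ge0 ?gamma_weight_ge0.
rewrite muleA -EFinM (muleC (g t)) muleA -EFinM.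
rewrite (_ : 4 * (A * _) * _ * _ = 4 * B * A * expR T * om t)//.
by rewrite expRD expRN; field; rewrite gt_eqF// expR_gt0.
Qed.

Lemma ge0_integral_itv_split (s : R) (h : R -> \bar R) : s <= T ->
  measurable_fun setT h -> (forall t, 0 <= h t)%E ->
  (\int[mu]_(t in `]-oo, T]) h t =
   \int[mu]_(t in `]-oo, s]) h t + \int[mu]_(t in `[s, T]) h t)%E.
Proof.
move=> sT mh h0; rewrite -[X in (_ + X)%E]integral_itv_obnd_cbnd; last first.
  exact: measurable_funTS.
rewrite -ge0_integral_setU//.
- congr (integral _ _ _); apply/seteqP; split => t /=; rewrite !in_itv/=.
    by move=> tT; case: (leP t s) => [|st]; [left|right].
  by case=> [/le_trans|/andP[]]//; apply.
- exact: measurable_funTS.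
- apply/disj_setPLR => t /=; rewrite !in_itv/= => ts; rewrite ltNge ts.
  by [].
Qed.

Hypotheses (a0 : 0 < a) (aT : - ln a <= T).
Hypothesis hA : forall y, 0 <= y -> y ^+ 2 <= A * expR y.
Hypothesis kA : Num.max 1 a ^+ 2 / a ^+ 3 <= A * expR T.

(** One multiplier on each side of [t0 = - ln a], where [exp (- t) - a] changes sign. On the left
    [h = k * exp t] is positive; on the right [h = t - T] vanishes at [T]. At [t0] the deviation of
    [m] is zero, so all boundary terms have the required sign. The factor [k = max(1, a)] secures
    [h' + h * (exp (- t) - a) >= 1] on the left, using [a * exp t <= 1] there. *)
Lemma gamma_hardy :
  (\int[mu]_(t in `]-oo, T]) ((m t - m (- ln a)) ^+ 2 * om t)%:E <=
   \int[mu]_(t in `]-oo, T]) ((4 * B * A * expR T)%:E * (g t * (om t)%:E)))%E.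
Proof.
have cm := is_derive_continuous dm.
have kA' := kA; set k := Num.max 1 a in kA' *; set t0 := - ln a.
have mL : measurable_fun setT (fun t => ((m t - m t0) ^+ 2 * om t)%:E).
  apply/measurable_EFinP; apply: measurable_funM; last exact: measurable_gamma_weight.
  apply: measurable_funX; apply: measurable_funB => //.
  exact: continuous_measurable_fun.
have L0 t : (0 <= ((m t - m t0) ^+ 2 * om t)%:E)%E.
  by rewrite lee_fin mulr_ge0 ?sqr_ge0 ?gamma_weight_ge0.
have mU : measurable_fun setT (fun t => (4 * B * A * expR T)%:E * (g t * (om t)%:E))%E.
  apply: measurable_funeM; apply: emeasurable_funM => //.
  by apply/measurable_EFinP; exact: measurable_gamma_weight.
have A0 : 0 <= A by have := hA (lexx 0); rewrite expr0n/= expR0 mulr1.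
have U0 t : (0 <= (4 * B * A * expR T)%:E * (g t * (om t)%:E))%E.
  rewrite mule_ge0 ?lee_fin ?mulr_ge0 ?expR_ge0// mule_ge0//.
  by rewrite lee_fin gamma_weight_ge0.
rewrite (ge0_integral_itv_split aT mL L0) (ge0_integral_itv_split aT mU U0).
have et0 : expR (- t0) = a by rewrite opprK lnK.
apply: leeD.
- rewrite {1}itvNy_bnd_bigcup_BLeft; apply: ge0_integral_bigcup_le => //.
    move=> i j ij; rewrite subsetEset; apply: subset_itvScc => //=.
    by rewrite bnd_simp lerD2l lerN2 ler_nat.
  move=> i; apply: (@le_trans _ _ (\int[mu]_(t in `[(t0 - i%:R)%R, t0])
      ((4 * B * A * expR T)%:E * (g t * (om t)%:E)))%E); last first.
    apply: ge0_subset_integral => //; first exact: measurable_funTS.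
    by move=> t /=; rewrite !in_itv/= => /andP[].
  have k1 : 1 <= k by rewrite le_max lexx.
  have ka : a <= k by rewrite le_max lexx orbT.
  have dexp (t : R) : is_derive t 1 (fun t => k * expR t) (k * expR t).
    by apply: is_derive_eq; rewrite /GRing.scale/=; ring.
  have etA (t : R) : t <= t0 -> a * expR t <= 1.
    move=> tt0; rewrite -et0 -ler_pdivlMl ?expR_gt0// mulr1 -expRN opprK.
    by rewrite ler_expR.
  apply: (gamma_hardy_itv (h := fun t => k * expR t) (h' := fun t => k * expR t)) => //.
  + by rewrite gerBl.
  + move=> t; exact: is_derive_continuous dexp t.
  + move=> t; rewrite in_itv/= => /andP[_ tt0].
    rewrite (_ : _ + _ = k * (1 + (1 - a) * expR t)); last first.
      by rewrite expRN; field; rewrite gt_eqF// expR_gt0.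
    have := etA t tt0; have := expR_gt0 t; move: (expR t) => e e0 ae.
    have [a1|a1] := leP a 1.
      by rewrite /k (max_idPl _)// mul1r lerDl mulr_ge0 ?subr_ge0// ltW.
    rewrite /k (max_idPr (ltW a1)) -subr_ge0.
    rewrite (_ : _ - 1 = (1 - a * e) * (a - 1)); last by ring.
    by rewrite mulr_ge0 ?subr_ge0// ltW.
  + move=> t; rewrite in_itv/= => /andP[_ tt0].
    rewrite expRD expRN mulrA ler_pdivlMr ?expR_gt0//.
    apply: le_trans kA'; rewrite ler_pdivlMr ?exprn_gt0//.
    have := etA t tt0; have := expR_gt0 t; move: (expR t) => e e0 ae.
    rewrite (_ : _ * a ^+ 3 = k ^+ 2 * (a * e) ^+ 3); last by ring.
    by rewrite ler_piMr ?sqr_ge0// exprn_ile1// mulr_ge0 ?(ltW a0)// ltW.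
  + by rewrite mulr_ge0 ?sqr_ge0// mulr_ge0 ?expR_ge0// (le_trans _ k1).
  + by rewrite subrr expr0n mul0r.
- have dT (t : R) : is_derive t 1 (fun t => t - T) 1.
    by apply: is_derive_eq; rewrite subr0.
  apply: (gamma_hardy_itv (h := fun t => t - T) (h' := fun=> 1)) => //.
  + by move=> t; exact: cvg_cst.
  + move=> t; rewrite in_itv/= => /andP[tt0 tT].
    rewrite lerDl -mulrNN mulr_ge0 ?opprB ?subr_ge0//.
    by rewrite -et0 ler_expR lerN2.
  + move=> t; rewrite in_itv/= => /andP[tt0 tT].
    by rewrite -sqrrN opprB hA// subr_ge0.
  + by rewrite subrr expr0n mul0r.
  + by rewrite subrr mulr0.
Qed.

End gamma_hardy.

(** * Bounds on the Gamma function *)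

Section gamma_mass.
Context {R : realType}.
Notation mu := (@lebesgue_measure R).
Implicit Types p t : R.

(** This is [Gamma(p)], under the substitution [y = exp (- t)]. *)
Definition gamma_mass p : \bar R := (\int[mu]_t (gamma_weight p t)%:E)%E.

Lemma continuous_expRN p : continuous (fun t => expR (- (p * t))).
Proof.
move=> t; apply: continuous_comp; last exact: continuous_expR.
by apply: (@cvgN _ R^o); apply: cvgM; [exact: cvg_cst|exact: cvg_id].
Qed.

Lemma measurable_expRN p : measurable_fun setT (fun t => expR (- (p * t))).
Proof. by apply: continuous_measurable_fun; exact: continuous_expRN. Qed.

Lemma integral_expRN p (T : R) : 0 < p ->
  (\int[mu]_(t in `[T, +oo[) (expR (- (p * t)))%:E = (expR (- (p * T)) / p)%:E)%E.
Proof.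
move=> p0.
have dF (t : R) : is_derive t 1 (fun t => - (expR (- (p * t)) / p)) (expR (- (p * t))).
  by apply: is_derive_eq; rewrite /GRing.scale/=; field; rewrite gt_eqF.
rewrite (@ge0_continuous_FTC2y _ _ (fun t => - (expR (- (p * t)) / p)) T 0).
- by rewrite -EFinB sub0r opprK.
- by move=> t _; exact: expR_ge0.
- by apply: continuous_subspaceT; exact: continuous_expRN.
- rewrite -oppr0; apply: (@cvgN _ R^o); rewrite -(mul0r p^-1).
  apply: cvgM; last exact: cvg_cst.
  apply: (cvg_comp (fun t => p * t) (fun x => expR (- x))); last exact: cvgr_expR.
  by apply: gt0_cvgMry.
- by move=> t _; have := dF t => dFt; exact: ex_derive.
- by apply: cvg_at_right_filter; exact: is_derive_continuous dF T.
- by move=> t _; rewrite derive1E; have := dF t => dFt; rewrite derive_val.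
Qed.

Lemma gamma_mass_tail p (T : R) : 0 < p ->
  (\int[mu]_(t in `[T, +oo[) (gamma_weight p t)%:E <= (expR (- (p * T)) / p)%:E)%E.
Proof.
move=> p0; rewrite -integral_expRN//; apply: ge0_le_integral => //.
- by move=> t _; rewrite lee_fin gamma_weight_ge0.
- by apply: measurable_funTS; apply/measurable_EFinP; exact: measurable_gamma_weight.
- by apply: measurable_funTS; apply/measurable_EFinP; exact: measurable_expRN.
- by move=> t _; rewrite lee_fin ler_expR gerBl expR_ge0.
Qed.

Lemma gamma_mass_lty p : 0 < p -> (gamma_mass p < +oo)%E.
Proof.
move=> p0; rewrite /gamma_mass ge0_integral_sym; last 2 first.
- by apply/measurable_EFinP; exact: measurable_gamma_weight.
- by move=> t; rewrite lee_fin gamma_weight_ge0.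
apply: lte_add_pinfty.
  by apply: le_lt_trans (gamma_mass_tail 0 p0) _; rewrite ltry.
(* The tangent at [ln b] gives [exp t >= b * (1 + t - ln b)]; with slope [b = p + 1] the weight at
   [- t] is at most [C * exp (- t)]. *)
pose b := p + 1; have b0 : 0 < b by rewrite addr_gt0.
pose C := expR (- (b * (1 - ln b))).
apply: (@le_lt_trans _ _ (\int[mu]_(t in `[0%R, +oo[) (C%:E * (expR (- (1 * t)))%:E))%E).
  apply: ge0_le_integral => //.
  - by move=> t _; rewrite lee_fin gamma_weight_ge0.
  - apply: measurable_funTS; apply/measurable_EFinP.
    exact: (measurableT_comp (measurable_gamma_weight p)).
  - apply: measurable_funTS; apply: measurable_funeM; apply/measurable_EFinP.
    exact: measurable_expRN.
  - move=> t _; rewrite -EFinM lee_fin /C -expRD ler_expR mulrN !opprK mul1r.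
    have := expR_ge1Dx (t - ln b).
    rewrite expRD expRN lnK// ler_pdivlMr// /b.
    by move=> h; move: h; rewrite /b; lra.
rewrite ge0_integralZl//.
- by rewrite integral_expRN// -EFinM ltry.
- by apply: measurable_funTS; apply/measurable_EFinP; exact: measurable_expRN.
- by rewrite lee_fin expR_ge0.
Qed.

(* Integrate exp (- y) >= exp (- p) (1 + p - y) with y = exp (- t) over t >= - ln k. *)
Lemma gamma_mass_ge p (k : R) : 0 < p -> 0 < k -> k <= p + 1 ->
  ((expR (p * (ln k - 1)) / p)%:E <= gamma_mass p)%E.
Proof.
move=> p0 k0 kp.
pose I := (\int[mu]_(t in `[(- ln k)%R, +oo[) (gamma_weight p t)%:E)%E.
apply: (@le_trans _ _ I); last first.
  apply: ge0_subset_integral => //.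
  - by apply/measurable_EFinP; exact: measurable_gamma_weight.
  - by move=> t _; rewrite lee_fin gamma_weight_ge0.
have mexp u q : measurable_fun (`[(- ln k), +oo[ : set R)
    (fun t => u%:E * (expR (- (q * t)))%:E)%E.
  apply: measurable_funTS; apply: measurable_funeM.
  by apply/measurable_EFinP; exact: measurable_expRN.
have Iexp u q : 0 <= u -> 0 < q ->
    (\int[mu]_(t in `[(- ln k)%R, +oo[) (u%:E * (expR (- (q * t)))%:E) =
     (u * (expR (q * ln k) / q))%:E)%E.
  move=> u0 q0; rewrite ge0_integralZl//.
  - by rewrite integral_expRN// mulrN opprK -EFinM.
  - by apply: measurable_funTS; apply/measurable_EFinP; exact: measurable_expRN.
have mw : measurable_fun (`[(- ln k), +oo[ : set R) (fun t => (gamma_weight p t)%:E).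
  by apply: measurable_funTS; apply/measurable_EFinP; exact: measurable_gamma_weight.
have p10 : 0 < p + 1 by rewrite addr_gt0.
(* The minorant [exp (- p) * (1 + p - y)] need not be nonnegative, so its negative term is added to
   [I] instead. *)
have H : ((expR (- p) * (1 + p) * (expR (p * ln k) / p))%:E <=
    I + (expR (- p) * (expR ((p + 1) * ln k) / (p + 1)))%:E)%E.
  rewrite -!Iexp ?mulr_ge0 ?expR_ge0 ?addr_ge0 ?(ltW p0)//.
  rewrite -ge0_integralD; last 5 first.
  - exact: measurable_itv.
  - by move=> t _; rewrite lee_fin gamma_weight_ge0.
  - exact: mw.
  - by move=> t _; rewrite mule_ge0 ?lee_fin ?expR_ge0.
  - exact: mexp.
  apply: ge0_le_integral => //.
  - by move=> t _; rewrite mule_ge0 ?lee_fin ?mulr_ge0 ?expR_ge0 ?addr_ge0 ?(ltW p0).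
  - exact: mexp.
  - by apply: emeasurable_funD => //; exact: mexp.
  - move=> t _; rewrite -!EFinM -EFinD lee_fin /gamma_weight.
    have := expR_ge1Dx (p - expR (- t)).
    rewrite (_ : - (p * t) - expR (- t) = - (p * t) - p + (p - expR (- t))); last by ring.
    rewrite (_ : - ((p + 1) * t) = - (p * t) + - t); last by ring.
    move=> h; rewrite expRD -subr_ge0 in h; rewrite !expRD -subr_ge0.
    set E := expR p * _ in h *.
    have := mulr_ge0 (mulr_ge0 (expR_ge0 (- (p * t))) (expR_ge0 (- p))) h.
    by move=> /le_trans; apply; rewrite le_eqVlt; apply/orP; left; apply/eqP; ring.
rewrite -leeBlDr// in H; apply: le_trans H; rewrite -EFinB lee_fin.
rewrite mulrDl mul1r mulrBr mulr1 !expRD lnK ?posrE//.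
move: (expR (- p)) (expR_gt0 (- p)) (expR (p * ln k)) (expR_gt0 (p * ln k)) => u u0 v v0.
(* The surplus is nonnegative exactly because [k <= p + 1]. *)
rewrite -subr_ge0 (_ : _ - _ = u * v * (p + 1 - k) / (p + 1)); last first.
  by field; rewrite !gt_eqF.
by rewrite divr_ge0 ?(ltW p10)// mulr_ge0 ?subr_ge0// mulr_ge0// ltW.
Qed.

End gamma_mass.

(** * The generalized Cauchy measure *)

Section cauchy_mixture.
Context {R : realType}.
Notation mu := (@lebesgue_measure R).

(** Translating [t] by [ln (1 + s)] absorbs the factor [1 + s] and leaves the power
    [(1 + s)^(- p)]. *)
Lemma integral_gamma_shift (p s : R) : 0 <= s ->
  (\int[mu]_t (expR (- (p * t) - expR (- t) * (1 + s)))%:E =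
   (expR (- (p * ln (1 + s))))%:E * gamma_mass p)%E.
Proof.
move=> s0; have s1 : 0 < 1 + s by rewrite ltr_pwDl.
pose F (t : R) : R := t - ln (1 + s).
have dF (t : R) : is_derive t 1 F 1 by rewrite /F; apply: is_derive_eq; rewrite subr0.
have F'E : F^`()%classic = cst 1.
  by apply/funext => t; rewrite derive1E; have := dF t => dFt; rewrite derive_val.
rewrite /gamma_mass (@increasing_ge0_integration_by_substitutionT _ F (gamma_weight p)); last 9 first.
- by move=> x y xy; rewrite /F ltrD2r.
- by rewrite F'E => t; exact: cvg_cst.
- by rewrite F'E; exact: is_cvg_cst.
- by rewrite F'E; exact: is_cvg_cst.
- by move=> t; have := dF t => dFt; exact: ex_derive.
- exact: cvg_addrr_Ny.
- exact: cvg_addrr.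
- exact: (@continuous_gamma_weight R p).
- by move=> t; exact: gamma_weight_ge0.
rewrite -ge0_integralZl//; last 2 first.
- apply/measurable_EFinP; rewrite F'E; apply: measurable_funM => //.
  apply: (measurableT_comp (measurable_gamma_weight p)).
  exact: measurable_funB.
- by move=> t _; rewrite lee_fin F'E mulr_ge0// gamma_weight_ge0.
apply: eq_integral => t _; rewrite -EFinM F'E; congr EFin.
rewrite !fctE mulr1 /gamma_weight -expRD /F; congr expR.
by rewrite opprB (addrC (ln _)) expRD lnK//; ring.
Qed.

Variables (d : nat) (nu : R).
Hypothesis nu0 : 0 < nu.

Let a := nu / 2.
Let p := (d%:R + nu) / 2.

Let p0 : 0 < p. Proof. by rewrite divr_gt0// ltr_wpDl. Qed.

(** The Gamma weight times the Gaussian density has exponent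
    [- (a + d / 2) t - exp (- t) (1 + |x|^2)] with [a + d / 2 = p]; Tonelli and
    [integral_gamma_shift] integrate [t] out. Nonnegative extended [h] cover the normalization
    [h = 1], squared deviations and squared gradients at once. *)
Lemma cauchy_mixture (h : 'rV[R]_d -> \bar R) :
  measurable_fun setT h -> (forall x, 0 <= h x)%E ->
  ((Num.sqrt pi^-1 ^+ d)%:E * gamma_mass p *
     \int[lebesgue_rV R d]_x (h x * (expR (- cauchy_potential nu x))%:E) =
   \int[mu]_t ((gamma_weight a t)%:E * \int[gauss_rV (expR (- t)) d]_x h x))%E.
Proof.
move=> mh h0.
pose J (z : measurableTypeR R * 'rV[R]_d) : \bar R :=
  (h z.2 * (Num.sqrt pi^-1 ^+ d *
            expR (- (p * z.1) - expR (- z.1) * (1 + sqnorm z.2)))%:E)%E.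
have Cd0 : 0 <= Num.sqrt pi^-1 ^+ d :> R by rewrite exprn_ge0.
have J0 z : (0 <= J z)%E by rewrite mule_ge0// lee_fin mulr_ge0 ?expR_ge0.
have ms1 : measurable_fun setT (fun z : measurableTypeR R * 'rV[R]_d => sqnorm z.2).
  exact: (measurableT_comp (@measurable_sqnorm R d)).
have mJ : measurable_fun setT J.
  apply: emeasurable_funM; first exact: (measurableT_comp mh).
  apply/measurable_EFinP; apply: measurable_funM => //.
  apply: measurableT_comp => //; apply: measurable_funB => //.
    by apply: measurableT_comp => //; exact: measurable_funM.
  apply: measurable_funM; last exact: measurable_funD.
  by apply: measurableT_comp => //; exact: measurableT_comp.
transitivity (\int[lebesgue_rV R d]_x \int[mu]_t J (t, x))%E; last first.
  rewrite -(fubini_tonelli J)//; apply: eq_integral => t _.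
  rewrite ge0_integral_gauss_rV ?expR_gt0// -ge0_integralZl//; last 2 first.
  - by move=> x _; rewrite mule_ge0// lee_fin gauss_rV_pdf_ge0.
  - by rewrite lee_fin gamma_weight_ge0.
  - apply: eq_integral => x _; rewrite /J/= muleCA -EFinM; congr (_ * _%:E)%E.
    rewrite gauss_rV_pdf_expR /gamma_weight mulrCA -expRD; congr (_ * expR _).
    by rewrite /p /a; field.
  - apply: emeasurable_funM => //; apply/measurable_EFinP.
    exact: measurable_gauss_rV_pdf.
have G0 : (0 <= gamma_mass p)%E by apply: integral_ge0 => t _; rewrite lee_fin gamma_weight_ge0.
have mV : measurable_fun setT (fun x : 'rV[R]_d => (expR (- cauchy_potential nu x))%:E).
  apply/measurable_EFinP; apply: measurableT_comp => //; apply: measurableT_comp => //.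
  apply: measurable_funM => //; apply: measurableT_comp => //.
  apply: measurable_funD => //.
  by under eq_fun do rewrite enorm_sqr; exact: measurable_sqnorm.
have Gfin : gamma_mass p \is a fin_num by rewrite ge0_fin_numE// gamma_mass_lty.
rewrite -ge0_integralZl//; last 3 first.
- exact: emeasurable_funM.
- by move=> x _; rewrite mule_ge0// lee_fin expR_ge0.
- by rewrite mule_ge0.
apply: eq_integral => x _; rewrite /J/=.
under [RHS]eq_integral do rewrite EFinM muleA.
rewrite ge0_integralZl//.
- rewrite integral_gamma_shift ?sqnorm_ge0//.
  rewrite /cauchy_potential enorm_sqr -/p.
  by rewrite muleACA (muleC _ (h x)) (muleC (gamma_mass p)).
- apply/measurable_EFinP; apply: measurableT_comp => //; apply: measurable_funB => //.
    by apply: measurableT_comp => //; exact: measurable_funM.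
  by apply: measurable_funM => //; apply: measurableT_comp => //.
- by rewrite mule_ge0.
Qed.

End cauchy_mixture.

Section cauchy_measure.
Context {R : realType} (d : nat) (nu : R).
Hypothesis nu0 : 0 < nu.
Notation mu := (@lebesgue_measure R).
Notation leb := (lebesgue_rV R d).
Notation V := (@cauchy_potential R d nu).

Let a := nu / 2.
Let p := (d%:R + nu) / 2.
Let a0 : 0 < a. Proof. by rewrite divr_gt0. Qed.
Let p0 : 0 < p. Proof. by rewrite divr_gt0// ltr_wpDl. Qed.

Lemma gamma_mass_gt0 (q : R) : 0 < q -> (0 < gamma_mass q)%E.
Proof.
move=> q0; apply: lt_le_trans (gamma_mass_ge q0 ltr01 _).
  by rewrite lte_fin divr_gt0// expR_gt0.
by rewrite lerDr ltW.
Qed.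

Lemma gamma_mass_fin_num (q : R) : 0 < q -> gamma_mass q \is a fin_num.
Proof. by move=> q0; rewrite ge0_fin_numE ?gamma_mass_lty// ltW// gamma_mass_gt0. Qed.

Let C : R := Num.sqrt pi^-1 ^+ d * fine (gamma_mass p).

Let C0 : 0 < C.
Proof.
rewrite mulr_gt0 ?exprn_gt0 ?sqrtr_gt0 ?invr_gt0 ?pi_gt0//.
by rewrite fine_gt0// gamma_mass_gt0// gamma_mass_lty.
Qed.

Let CE : ((Num.sqrt pi^-1 ^+ d)%:E * gamma_mass p = C%:E)%E.
Proof. by rewrite /C EFinM fineK// gamma_mass_fin_num. Qed.

Lemma measurable_cauchy_potential : measurable_fun setT (fun x => expR (- V x)).
Proof.
apply: measurableT_comp => //; apply: measurableT_comp => //.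
apply: measurable_funM => //; apply: measurableT_comp => //.
apply: measurable_funD => //.
by under eq_fun do rewrite enorm_sqr; exact: measurable_sqnorm.
Qed.

Lemma integral_cauchy_potential :
  (C%:E * \int[leb]_x (expR (- V x))%:E = gamma_mass a)%E.
Proof.
have := @cauchy_mixture R d nu nu0 (fun=> 1%E) (@measurable_cst _ _ _ _ _ _) (fun=> lee01).
rewrite CE; under eq_integral do rewrite mul1e.
move=> ->; apply: eq_integral => t _.
by rewrite integral_prob_cst mule1.
Qed.

Lemma cauchy_normalization :
  exists2 Z : R, 0 < Z & (\int[leb]_x (expR (- V x))%:E = Z%:E)%E.
Proof.
have IE := integral_cauchy_potential.
have : (\int[leb]_x (expR (- V x))%:E = (C^-1 * fine (gamma_mass a))%:E)%E.
  rewrite EFinM fineK ?gamma_mass_fin_num// -IE muleA -EFinM mulVf ?gt_eqF//.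
  by rewrite mul1e.
move=> ->; exists (C^-1 * fine (gamma_mass a)) => //.
by rewrite mulr_gt0 ?invr_gt0// fine_gt0// gamma_mass_gt0// gamma_mass_lty.
Qed.

Lemma exists_cauchy_probability :
  exists P : probability 'rV[R]_d R, has_density_propto_exp V P.
Proof.
have [Z Z0 ZE] := cauchy_normalization.
have mV := measurable_cauchy_potential.
have [|||P PE] := @probability_of_density _ _ _ leb (fun x => Z^-1 * expR (- V x)).
- exact: measurable_funM.
- by move=> x; rewrite mulr_ge0 ?expR_ge0// invr_ge0 ltW.
- under eq_integral do rewrite EFinM.
  rewrite ge0_integralZl//; last by rewrite lee_fin invr_ge0 ltW.
    by rewrite ZE -EFinM mulVf// gt_eqF.
  exact/measurable_EFinP.
exists P; exists Z => // A mA; rewrite PE//.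
under eq_integral do rewrite EFinM.
rewrite ge0_integralZl//; last by rewrite lee_fin invr_ge0 ltW.
by apply: measurable_funTS; exact/measurable_EFinP.
Qed.

(** The factor [gamma_mass a] stays on the left: estimates are made on the mixture, and it is
    cancelled once, in [cauchy_wpi_bounded]. *)
Lemma cauchy_expectation (P : probability 'rV[R]_d R) :
  has_density_propto_exp V P -> forall h : 'rV[R]_d -> \bar R,
  measurable_fun setT h -> (forall x, 0 <= h x)%E ->
  (gamma_mass a * \int[P]_x h x =
   \int[mu]_t ((gamma_weight a t)%:E * \int[gauss_rV (expR (- t)) d]_x h x))%E.
Proof.
move=> [Z Z0 PE] h mh h0; have mV := measurable_cauchy_potential.
have mZV : measurable_fun setT (fun x => Z^-1 * expR (- V x)) by exact: measurable_funM.
have ZV0 x : 0 <= Z^-1 * expR (- V x) by rewrite mulr_ge0 ?expR_ge0// invr_ge0 ltW.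
have PE' A : measurable A -> P A = (\int[leb]_(x in A) (Z^-1 * expR (- V x))%:E)%E.
  move=> mA; rewrite PE//; under [RHS]eq_integral do rewrite EFinM.
  rewrite ge0_integralZl//; last by rewrite lee_fin invr_ge0 ltW.
  by apply: measurable_funTS; exact/measurable_EFinP.
(* Total mass 1 identifies the constant [Z], of which only existence is given. *)
have ZE : (\int[leb]_x (expR (- V x))%:E = Z%:E)%E.
  have := PE setT measurableT; rewrite probability_setT => /(congr1 (fun x => Z%:E * x)%E).
  by rewrite mule1 muleA -EFinM divff ?gt_eqF// mul1e.
rewrite -(cauchy_mixture nu0 mh h0) CE -integral_cauchy_potential ZE.
rewrite (ge0_integral_density mZV ZV0 PE' mh h0).
under eq_integral do rewrite EFinM muleCA.
rewrite ge0_integralZl//.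
- by rewrite [LHS]muleA -!EFinM mulfK ?gt_eqF.
- by apply: emeasurable_funM => //; exact/measurable_EFinP.
- by move=> x _; rewrite mule_ge0// lee_fin expR_ge0.
- by rewrite lee_fin invr_ge0 ltW.
Qed.

End cauchy_measure.

(** * The cutoff and the numerical constants *)

Section cauchy_wpi.
Context {R : realType}.

Lemma expR1_ge2 : 2 <= expR 1 :> R.
Proof. by have := expR_ge1Dx (1 : R); rewrite -natr1 addrC. Qed.

Lemma expR1_le4 : expR 1 <= 4 :> R.
Proof.
have h : 2^-1 <= expR (- 2^-1) :> R.
  by apply: le_trans (expR_ge1Dx _); rewrite le_eqVlt; apply/orP; left; apply/eqP; field.
have h2 : expR (2^-1) <= 2 :> R.
  by move: h; rewrite expRN lef_pV2 ?posrE ?expR_gt0.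
have -> : expR 1 = expR 2^-1 * expR 2^-1 :> R by rewrite -expRD; congr expR; field.
apply: (@le_trans _ _ (2 * 2)); first by rewrite ler_pM ?expR_ge0.
by rewrite -natrM.
Qed.

(** [4 / e^2] is the maximum of [y^2 * exp (- y)], attained at [y = 2]; it comes from the tangent of
    [exp (y / 2)] at that point. *)
Lemma sqr_le_expR (y : R) : 0 <= y -> y ^+ 2 <= 4 / expR 1 ^+ 2 * expR y.
Proof.
move=> y0; have := expR_ge1Dx (y / 2 - 1).
rewrite addrCA subrr addr0 expRD expRN => h.
have h2 : y <= 2 * (expR (y / 2) / expR 1) by lra.
have : y ^+ 2 <= (2 * (expR (y / 2) / expR 1)) ^+ 2 by rewrite ler_sqr ?nnegrE// (le_trans y0).
move=> /le_trans; apply; rewrite le_eqVlt; apply/orP; left; apply/eqP.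
rewrite [in RHS](_ : y = y / 2 + y / 2); last by field.
by rewrite expRD; field; rewrite gt_eqF// expR_gt0.
Qed.

Section constants.
Variables (a r : R).
Hypotheses (a0 : 0 < a) (r0 : 0 < r) (r4 : r <= 4^-1).

Let k : R := Num.max 1 a.

(* exp (- wpi_cutoff) = k / e * r^(1 / a), the level below which Gamma(a) has
   mass at most r; see [gamma_tail_cutoff]. *)
Definition wpi_cutoff : R := 1 - ln k - ln r / a.

(** The [A] of [gamma_hardy]. The factor [k] cancels against the one in [exp wpi_cutoff], and
    [2 / e] dominates the [4 / e^2] of [sqr_le_expR]. *)
Definition wpi_const : R := 2 * k / (a * expR 1).

Let k1 : 1 <= k. Proof. by rewrite le_max lexx. Qed.
Let ka : a <= k. Proof. by rewrite le_max lexx orbT. Qed.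
Let k0 : 0 < k. Proof. exact: lt_le_trans k1. Qed.

Let lnr : 1 <= - ln r.
Proof.
rewrite -lnV ?posrE// -[leLHS](expRK 1) ler_ln ?posrE ?invr_gt0 ?expR_gt0//.
by rewrite (le_trans expR1_le4)// -[leLHS]invrK lef_pV2 ?posrE.
Qed.

Lemma expR_wpi_cutoff : expR wpi_cutoff = expR 1 / k * expR (- (ln r / a)).
Proof. by rewrite /wpi_cutoff expRD expRD [expR (- ln k)]expRN lnK. Qed.

Lemma wpi_const_expR_cutoff :
  wpi_const * expR wpi_cutoff = 2 / a * expR (- (ln r / a)).
Proof.
rewrite expR_wpi_cutoff /wpi_const; field.
by rewrite !gt_eqF// expR_gt0.
Qed.

(** For [a >= 1] the term [- ln k] is [- ln a]. For [a < 1], [ln (1 / a) <= 1 / a - 1], and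
    [- ln r / a >= 1 / a] because [r <= 1/4 <= 1/e]. *)
Lemma wpi_cutoff_ge : - ln a <= wpi_cutoff.
Proof.
have ra : a^-1 <= - (ln r / a) by rewrite -mulNr -[leLHS]mul1r ler_wpM2r// invr_ge0 ltW.
have [a1|a1] := leP 1 a.
  rewrite /wpi_cutoff /k (max_idPr a1).
  have ai : 0 < a^-1 by rewrite invr_gt0.
  lra.
rewrite /wpi_cutoff /k (max_idPl (ltW a1)) ln1 -lnV ?posrE//.
have := le_ln1Dx (x := a^-1 - 1); rewrite addrCA subrr addr0.
rewrite -subr_gt0 opprK subrK invr_gt0 => /(_ a0) ?.
lra.
Qed.

Lemma wpi_const_sqr (y : R) : 0 <= y -> y ^+ 2 <= wpi_const * expR y.
Proof.
move=> /sqr_le_expR /le_trans; apply; rewrite ler_wpM2r ?expR_ge0//.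
have e0 := expR_gt0 (1 : R).
rewrite /wpi_const ler_pdivlMr ?mulr_gt0//.
rewrite (_ : _ * (a * expR 1) = 2 * (2 / expR 1 * a)); last by field; rewrite gt_eqF.
rewrite ler_wpM2l// (le_trans _ ka)// ler_piMl ?(ltW a0)//.
by rewrite ler_pdivrMr// mul1r expR1_ge2.
Qed.

(** The hypothesis [kA] of [gamma_hardy], i.e. [(k / a)^2 <= 2 r^(-1/a)]. For [a >= 1] the left side
    is 1; for [a < 1] it is [y^2] with [y = 1 / a], and [y^2 <= exp y <= r^(-1/a)]. *)
Lemma wpi_const_cutoff : k ^+ 2 / a ^+ 3 <= wpi_const * expR wpi_cutoff.
Proof.
rewrite wpi_const_expR_cutoff ler_pdivrMr ?exprn_gt0//.
rewrite (_ : 2 / a * _ * a ^+ 3 = 2 * expR (- (ln r / a)) * a ^+ 2); last first.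
  by field; rewrite gt_eqF.
have ra : a^-1 <= - (ln r / a) by rewrite -mulNr -[leLHS]mul1r ler_wpM2r// invr_ge0 ltW.
have ai0 : 0 < a^-1 by rewrite invr_gt0.
have [a1|a1] := leP 1 a.
  rewrite /k (max_idPr a1) ler_peMl ?sqr_ge0//.
  have : 1 <= expR (- (ln r / a)) by rewrite -expR0 ler_expR (le_trans _ ra)// ltW.
  lra.
rewrite /k (max_idPl (ltW a1)) expr1n -ler_pdivrMr ?exprn_gt0// mul1r -exprVn.
apply: (le_trans (sqr_le_expR (ltW ai0))).
apply: (@le_trans _ _ (1 * expR (a^-1))).
  rewrite ler_wpM2r ?expR_ge0// ler_pdivrMr ?exprn_gt0 ?expR_gt0// mul1r.
  rewrite (_ : 4 = 2 ^+ 2); last by ring.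
  by rewrite ler_sqr ?nnegrE ?expR_ge0// expR1_ge2.
by apply: ler_pM => //; rewrite ?expR_ge0 ?ler1n// ler_expR.
Qed.

(** [e / (2 * k) <= 2] as [e <= 4] and [k >= 1]. This is the dimension-free share of
    [2 * (d / nu + 1)]. *)
Lemma expR_cutoff_half_le : expR wpi_cutoff / 2 <= 2 * expR (- (ln r / a)).
Proof.
rewrite expR_wpi_cutoff mulrAC ler_wpM2r ?expR_ge0// !ler_pdivrMr//.
by apply: (le_trans expR1_le4); have := k1; lra.
Qed.

(** The cutoff gives [exp (- a T) = r * (k / e)^a], and [(k / e)^a / a] is exactly the lower bound
    of [gamma_mass_ge], available since [k <= a + 1]. *)
Lemma gamma_tail_cutoff :
  (\int[lebesgue_measure]_(t in `[wpi_cutoff, +oo[) (gamma_weight a t)%:E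
   <= r%:E * gamma_mass a)%E.
Proof.
apply: le_trans (gamma_mass_tail _ a0) _.
have ka1 : k <= a + 1 by rewrite ge_max lerDl lerDr ler01 (ltW a0).
apply: le_trans (lee_wpmul2l _ (gamma_mass_ge a0 k0 ka1)); last by rewrite lee_fin ltW.
rewrite -EFinM lee_fin mulrA ler_wpM2r ?invr_ge0 ?(ltW a0)//.
rewrite le_eqVlt; apply/orP; left; apply/eqP.
rewrite (_ : - (a * wpi_cutoff) = ln r + a * (ln k - 1)).
  by rewrite expRD lnK.
by rewrite /wpi_cutoff; field; rewrite gt_eqF.
Qed.

End constants.

End cauchy_wpi.

(** * The inequality for functions with values in [[0, K]] *)

Section cauchy_bounded.
Context {R : realType} (d : nat) (nu : R).
Hypothesis nu0 : 0 < nu.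
Notation mu := (@lebesgue_measure R).

Let a := nu / 2.
Let a0 : 0 < a. Proof. by rewrite divr_gt0. Qed.

(** Against Lebesgue measure the parameter [t] enters through a jointly measurable density, so
    Tonelli applies. *)
Lemma measurable_gauss_expectation (h : 'rV[R]_d -> \bar R) :
  measurable_fun setT h -> (forall x, 0 <= h x)%E ->
  measurable_fun setT (fun t : R => \int[gauss_rV (expR (- t)) d]_x h x)%E.
Proof.
move=> mh h0.
pose J (z : measurableTypeR R * 'rV[R]_d) : \bar R :=
  (h z.2 * (Num.sqrt pi^-1 ^+ d *
            expR (- (d%:R / 2 * z.1) - expR (- z.1) * sqnorm z.2))%:E)%E.
have mJ : measurable_fun setT J.
  apply: emeasurable_funM; first exact: (measurableT_comp mh).
  apply/measurable_EFinP; apply: measurable_funM => //.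
  apply: measurableT_comp => //; apply: measurable_funB => //.
    by apply: measurableT_comp => //; exact: measurable_funM.
  apply: measurable_funM; last exact: (measurableT_comp (@measurable_sqnorm R d)).
  by apply: measurableT_comp => //; exact: measurableT_comp.
have J0 z : (0 <= J z)%E.
  by rewrite mule_ge0// lee_fin mulr_ge0 ?expR_ge0 ?exprn_ge0.
rewrite (_ : (fun t => _) = fubini_F (lebesgue_rV R d) J).
  exact: measurable_fun_fubini_tonelli_F.
apply/funext => t; rewrite ge0_integral_gauss_rV ?expR_gt0//.
by apply: eq_integral => x _; rewrite gauss_rV_pdf_expR.
Qed.

Variable P : probability 'rV[R]_d R.
Hypothesis P_density : has_density_propto_exp (cauchy_potential nu) P.
Variables (f : 'rV[R]_d -> R) (p : 'I_d -> 'rV[R]_d -> R) (K r : R).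
Hypotheses (fp : C1_rV f p) (fK : forall x, 0 <= f x <= K).
Hypotheses (r0 : 0 < r) (r4 : r <= 4^-1).

Let om := gamma_weight a.
Let T := wpi_cutoff a r.
Let m := gauss_mean f.
(** Any constant may serve as center when bounding a variance; this is the one at which
    [gamma_hardy] pins [m]. *)
Let c := m (- ln a).
Let g t := (\int[gauss_rV (expR (- t)) d]_x (\sum_i p i x ^+ 2)%:E)%E.
Let e t := (\int[gauss_rV (expR (- t)) d]_x ((f x - c) ^+ 2)%:E)%E.

Let mf : measurable_fun setT f. Proof. exact: measurable_C1 fp. Qed.

Let fK' x : `|f x| <= K.
Proof. by have /andP[? ?] := fK x; rewrite ger0_norm. Qed.

Let m_itv t : 0 <= m t <= K.
Proof.
apply/andP; split; last first.
  by apply: le_trans (ler_norm _) _; exact: norm_Rintegral_prob_le.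
by apply: Rintegral_ge0 => x _; have /andP[] := fK x.
Qed.

Let mgrad : measurable_fun setT (fun x => (\sum_i p i x ^+ 2)%:E).
Proof. by apply/measurable_EFinP; exact: measurable_C1_grad fp. Qed.

Let grad0 x : (0 <= (\sum_i p i x ^+ 2)%:E)%E.
Proof. by rewrite lee_fin sumr_ge0// => i _; exact: sqr_ge0. Qed.

Let mdev : measurable_fun setT (fun x => ((f x - c) ^+ 2)%:E).
Proof.
by apply/measurable_EFinP; apply: measurable_funX; exact: measurable_funB.
Qed.

Let mg : measurable_fun setT g.
Proof. exact: measurable_gauss_expectation. Qed.

Let g0 t : (0 <= g t)%E. Proof. exact: integral_ge0. Qed.

Let me : measurable_fun setT e.
Proof.
by apply: measurable_gauss_expectation => // x; rewrite lee_fin sqr_ge0.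
Qed.

Let e0 t : (0 <= e t)%E.
Proof. by apply: integral_ge0 => x _; rewrite lee_fin sqr_ge0. Qed.

Let om0 t : (0 <= (om t)%:E)%E.
Proof. by rewrite lee_fin gamma_weight_ge0. Qed.

Let mom : measurable_fun setT (fun t => (om t)%:E).
Proof. by apply/measurable_EFinP; exact: measurable_gamma_weight. Qed.

(** Variance under one component plus squared bias; the Poincare constant [exp t / 2] is largest at
    [t = T]. *)
Let e_le t : t <= T ->
  (e t <= (expR T / 2)%:E * g t + ((m t - c) ^+ 2)%:E)%E.
Proof.
move=> tT; rewrite /e (integral_sqr_dev _ _ mf fK') leeD//.
apply: le_trans (gauss_rV_poincare (expR_gt0 (- t)) fp fK') _.
under eq_integral do rewrite EFinM.
rewrite ge0_integralZl//; apply: lee_wpmul2r; first exact: g0.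
rewrite lee_fin invfM expRN invrK mulrC.
by rewrite ler_wpM2r// ler_expR.
Qed.

Let tail_le :
  (\int[mu]_(t in `]T, +oo[) ((om t)%:E * e t) <= (r * K ^+ 2)%:E * gamma_mass a)%E.
Proof.
apply: (@le_trans _ _ (\int[mu]_(t in `]T, +oo[) ((K ^+ 2)%:E * (om t)%:E))%E).
  apply: ge0_le_integral => //.
  - by move=> t _; rewrite mule_ge0.
  - by apply: measurable_funTS; exact: emeasurable_funM.
  - by apply: measurable_funTS; exact: measurable_funeM.
  move=> t _; rewrite muleC lee_wpmul2r//.
  rewrite -(integral_prob_cst (gauss_rV (expR (- t)) d)).
  apply: ge0_le_integral => //.
  - by move=> x _; rewrite lee_fin sqr_ge0.
  - move=> x _; rewrite lee_fin -real_normK ?num_real// ler_sqr ?nnegrE//.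
      have /andP[? ?] := fK x; have /andP[? ?] := m_itv (- ln a).
      by rewrite ler_norml /c; apply/andP; split; lra.
    by have /andP[h1 h2] := fK x; exact: le_trans h2.
rewrite ge0_integralZl//; last 2 first.
- exact: measurable_funTS.
- by rewrite lee_fin sqr_ge0.
rewrite integral_itv_obnd_cbnd; last exact: measurable_funTS.
rewrite (mulrC r) (EFinM (K ^+ 2)) -muleA; apply: lee_wpmul2l.
  by rewrite lee_fin sqr_ge0.
exact: gamma_tail_cutoff.
Qed.

Let bulk_le :
  (\int[mu]_(t in `]-oo, T]) ((om t)%:E * e t) <=
   (expR T / 2 + d%:R / a * expR (- (ln r / a)))%:E * \int[mu]_t ((om t)%:E * g t))%E.
Proof.
have mF : measurable_fun setT (fun t => ((m t - c) ^+ 2 * om t)%:E).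
  apply/measurable_EFinP; apply: measurable_funM; last exact: measurable_gamma_weight.
  apply: measurable_funX; apply: measurable_funB => //.
  apply: continuous_measurable_fun; apply: is_derive_continuous.
  by move=> t; exact: is_derive_gauss_mean mf fK t.
have F0 t : (0 <= ((m t - c) ^+ 2 * om t)%:E)%E.
  by rewrite lee_fin mulr_ge0 ?sqr_ge0 ?gamma_weight_ge0.
have mgo : measurable_fun setT (fun t => g t * (om t)%:E)%E by exact: emeasurable_funM.
have go0 t : (0 <= g t * (om t)%:E)%E by rewrite mule_ge0.
have eT0 : (0 <= (expR T / 2)%:E)%E by rewrite lee_fin divr_ge0 ?expR_ge0.
apply: (@le_trans _ _ (\int[mu]_(t in `]-oo, T])
    ((expR T / 2)%:E * (g t * (om t)%:E) + ((m t - c) ^+ 2 * om t)%:E))%E).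
  apply: ge0_le_integral => //.
  - by move=> t _; rewrite mule_ge0.
  - by apply: measurable_funTS; exact: emeasurable_funM.
  - apply: measurable_funTS; apply: emeasurable_funD => //.
    exact: measurable_funeM.
  move=> t /=; rewrite in_itv/= => tT.
  rewrite (muleC (om t)%:E) (EFinM ((m t - c) ^+ 2)) (muleA _ (g t)).
  rewrite -ge0_muleDl ?mule_ge0 ?lee_fin ?sqr_ge0//.
  by apply: lee_wpmul2r => //; exact: e_le.
rewrite ge0_integralD//; last 3 first.
- by move=> t _; rewrite mule_ge0.
- by apply: measurable_funTS; exact: measurable_funeM.
- exact: measurable_funTS.
have dm (t : R) : is_derive t 1 m (gauss_mean_deriv f t) by exact: is_derive_gauss_mean mf fK t.
have cm' : continuous (gauss_mean_deriv f).
  exact: continuous_gauss_mean_deriv mf fK.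
have m'g t : ((gauss_mean_deriv f t ^+ 2)%:E <= (d%:R / 8 * expR t)%:E * g t)%E.
  exact: sqr_gauss_mean_deriv_le mf fK _ _ fp.
have d8 : 0 <= d%:R / 8 :> R by rewrite divr_ge0.
(* With [A = wpi_const a] and [B = d / 8], the constant [4 * B * A * exp T] becomes
   [d / a * r^(-1/a)]. *)
have := @gamma_hardy _ a (wpi_const a) (d%:R / 8) T m _ g d8 dm cm' mg g0 m'g a0
  (wpi_cutoff_ge a0 r0 r4) (wpi_const_sqr a0) (wpi_const_cutoff a0 r0 r4).
rewrite -/c -/om => H; apply: le_trans (leeD (lexx _) H) _.
rewrite !ge0_integralZl//; last 3 first.
- exact: measurable_funTS.
- rewrite lee_fin -(mulrA _ (wpi_const a)) wpi_const_expR_cutoff//.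
  by rewrite !mulr_ge0 ?expR_ge0 ?invr_ge0// ltW.
- exact: measurable_funTS.
rewrite -ge0_muleDl//; last first.
  rewrite lee_fin -(mulrA _ (wpi_const a)) wpi_const_expR_cutoff//.
  by rewrite !mulr_ge0 ?expR_ge0 ?invr_ge0// ltW.
rewrite -(mulrA _ (wpi_const a)) wpi_const_expR_cutoff// -EFinD.
rewrite (_ : 4 * (d%:R / 8) * _ = d%:R / a * expR (- (ln r / a))); last first.
  by field; rewrite gt_eqF.
under [in leRHS]eq_integral do rewrite muleC.
apply: lee_wpmul2l; last by apply: ge0_subset_integral.
by rewrite lee_fin ?addr_ge0 ?mulr_ge0 ?expR_ge0 ?invr_ge0 ?(ltW a0).
Qed.

Lemma cauchy_wpi_bounded : exists2 u, 0 <= u <= K &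
  (\int[P]_x ((f x - u) ^+ 2)%:E <=
   (2 * (d%:R / nu + 1) * expR (- (ln r / a)))%:E * \int[P]_x (\sum_i p i x ^+ 2)%:E
   + (r * K ^+ 2)%:E)%E.
Proof.
exists c; first exact: m_itv.
have Gfin := gamma_mass_fin_num a0; have G0 := gamma_mass_gt0 a0.
rewrite -(@lee_pmul2l _ (gamma_mass a))//.
rewrite (cauchy_expectation nu0 P_density)//; last by move=> x; rewrite lee_fin sqr_ge0.
rewrite -(setUv `]-oo, T]%classic) ge0_integral_setU//=; last 4 first.
- exact: measurableC.
- by rewrite setUv; exact: emeasurable_funM.
- by move=> t _; apply: mule_ge0; [exact: om0|exact: e0].
- by rewrite disj_set2E setICr eqxx.
rewrite setCitvl; apply: le_trans (leeD bulk_le tail_le) _.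
have I0 : (0 <= \int[P]_x (\sum_i p i x ^+ 2)%:E)%E by exact: integral_ge0.
rewrite -(cauchy_expectation nu0 P_density)//.
rewrite [leRHS]ge0_muleDr//; last 2 first.
- rewrite mule_ge0// lee_fin !mulr_ge0 ?expR_ge0// addr_ge0// divr_ge0// ltW//.
- by rewrite lee_fin mulr_ge0 ?sqr_ge0// ltW.
apply: leeD; last by rewrite muleC.
rewrite [leRHS]muleCA; apply: lee_wpmul2r; first by rewrite mule_ge0// ltW.
rewrite lee_fin.
apply: (le_trans (lerD (expR_cutoff_half_le a r) (lexx _))).
(* For [a = nu / 2], [2 + d / a = 2 * (d / nu + 1)]. *)
rewrite le_eqVlt; apply/orP; left; apply/eqP; rewrite /a; field.
by rewrite gt_eqF.
Qed.

End cauchy_bounded.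

(** * The oscillation in the extended reals *)

Section oscillation.
Context {R : realType} (d : nat).
Implicit Types f : 'rV[R]_d -> R.

Lemma Osc_ge_diff f x y : ((f x - f y)%:E <= Osc f)%E.
Proof.
rewrite EFinB; apply: leeB.
- by apply: ereal_sup_ubound; exists x.
- by apply: ereal_inf_lbound; exists y.
Qed.

(** The supremum is first shown to be a real [s]; every value is then at least [s - M], which bounds
    the infimum. *)
Lemma Osc_le f (M : R) : (forall x y, f x - f y <= M) -> (Osc f <= M%:E)%E.
Proof.
move=> fM; set S := ereal_sup (range (EFin \o f)).
have S0 : ((f 0)%:E <= S)%E by apply: ereal_sup_ubound; exists 0.
have SM : (S <= (f 0 + M)%:E)%E.
  by apply: ge_ereal_sup => _ [x _ <-]; rewrite lee_fin -lerBlDl.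
rewrite /Osc -/S; case ES : S SM S0 => [s| |]// _ _.
have Is : ((s - M)%:E <= ereal_inf (range (EFin \o f)))%E.
  apply: le_ereal_inf_tmp => _ [y _ <-]; rewrite lee_fin lerBlDr -lee_fin -ES.
  by apply: ge_ereal_sup => _ [x _ <-]; rewrite lee_fin -lerBlDl.
apply: le_trans (leeB (lexx _) Is) _.
by rewrite -EFinB lee_fin opprB addrC subrK.
Qed.

Lemma Osc_ge0 f : (0 <= Osc f)%E.
Proof. by have := Osc_ge_diff f 0 0; rewrite subrr. Qed.

Lemma Osc_affine_le f (c a : R) :
  (Osc (fun x => c * f x + a)%R <= `|c|%:E * Osc f)%E.
Proof.
(* For [c = 0] the convention [0 * +oo = 0] agrees with the zero oscillation of a constant. *)
have [->|c0] := eqVneq c 0.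
  rewrite normr0 mul0e; apply: Osc_le => x y.
  by rewrite !mul0r subrr.
have := Osc_ge0 f; have H := Osc_ge_diff f.
case: (Osc f) H => [M| |]// H _; last first.
  by rewrite gt0_muley ?leey// lte_fin normr_gt0.
rewrite -EFinM; apply: Osc_le => x y.
rewrite (_ : _ - _ = c * (f x - f y)); last by ring.
apply: (le_trans (ler_norm _)); rewrite normrM ler_wpM2l// ler_norml.
have := H x y; have := H y x; rewrite !lee_fin => h1 h2.
by rewrite h2 andbT; lra.
Qed.

(** The reverse inequality is [Osc_affine_le] for the inverse affine map. *)
Lemma Osc_affine f (c a : R) :
  (Osc (fun x => c * f x + a)%R = `|c|%:E * Osc f)%E.
Proof.
apply/eqP; rewrite eq_le Osc_affine_le/=.
have [->|c0] := eqVneq c 0; first by rewrite normr0 mul0e Osc_ge0.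
have := Osc_affine_le (fun x => c * f x + a) c^-1 (- (c^-1 * a)).
rewrite (_ : (fun x => c^-1 * _ + _) = f); last first.
  by apply/funext => x; field.
by rewrite normfV -lee_pdivlMl ?invrK ?invr_gt0 ?normr_gt0.
Qed.

Lemma Osc_fin_shift f (M : R) : (Osc f = M%:E)%E ->
  exists b, forall x, 0 <= f x - b <= M.
Proof.
move=> fM; exists (inf (range f)) => x.
have fxy y z : f y - f z <= M by rewrite -lee_fin -fM Osc_ge_diff.
apply/andP; split.
  rewrite subr_ge0; apply: ge_inf; last by exists x.
  by exists (f 0 - M) => _ [z _ <-]; rewrite lerBlDr -lerBlDl.
rewrite lerBlDr -lerBlDl; apply: lb_le_inf; first by exists (f 0); exists 0.
by move=> _ [z _ <-]; rewrite lerBlDr -lerBlDl.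
Qed.

End oscillation.

Lemma variance_le_sqr_dev dT (T : measurableType dT) (R : realType)
    (P : probability T R) (f : T -> R) (K u : R) :
  measurable_fun setT f -> (forall x, `|f x| <= K) ->
  ('V_P[f] <= \int[P]_x ((f x - u) ^+ 2)%:E)%E.
Proof.
move=> mf fK; apply: le_trans (integral_sqr_mean_le _ u mf fK).
rewrite /variance unlock !unlock le_eqVlt; apply/orP; left; apply/eqP.
by apply: eq_integral => x _; rewrite expr2.
Qed.

Section weak_poincare_cauchy.
Context {R : realType} (d : nat) (nu : R).
Hypothesis nu0 : 0 < nu.

Let beta r : R := 2 / nu + 2 * (d%:R / nu + 1) * r `^ (- (2 / nu)).

Let coef0 : 0 <= 2 * (d%:R / nu + 1).
Proof. by rewrite mulr_ge0// addr_ge0// divr_ge0// ltW. Qed.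

Let beta0 r : 0 <= beta r.
Proof.
apply: addr_ge0; first by rewrite divr_ge0// ltW.
by apply: mulr_ge0; [exact: coef0|exact: powR_ge0].
Qed.

Lemma Cinfty_C1 (f : 'rV[R]_d -> R) : Cinfty f -> C1_rV f (fun i => partial i f).
Proof.
move=> /(_ 1%N)[cf df]; split => // [i|i x].
  by have [_ []] := df i.
by have [dfi _] := df i; apply: DeriveDef; first exact: dfi.
Qed.

Variable P : probability 'rV[R]_d R.
Hypothesis P_density : has_density_propto_exp (cauchy_potential nu) P.

Lemma cauchy_variance_le (f : 'rV[R]_d -> R) (r M : R) :
  Cinfty f -> 0 < r -> Osc f = M%:E ->
  ('V_P[f] <= (beta r)%:E * 'E_P[fun x => (enorm (grad f x) ^+ 2)%R]
               + (r * M ^+ 2)%:E)%E.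
Proof.
move=> fC r0 fM; have fp := Cinfty_C1 fC; have mf := measurable_C1 fp.
have [b fb] := Osc_fin_shift fM.
have M0 : 0 <= M by rewrite -lee_fin -fM Osc_ge0.
have fK x : `|f x| <= M + `|b|.
  rewrite -(subrK b (f x)) (le_trans (ler_normD _ _))// lerD2r.
  by have /andP[h1 h2] := fb x; rewrite ger0_norm.
have EE : ('E_P[fun x => (enorm (grad f x) ^+ 2)%R] =
    \int[P]_x (\sum_i partial i f x ^+ 2)%:E)%E.
  rewrite unlock; apply: eq_integral => x _; rewrite enorm_sqr /sqnorm.
  by under eq_bigr do rewrite mxE.
have E0 : (0 <= \int[P]_x (\sum_i partial i f x ^+ 2)%:E)%E.
  by apply: integral_ge0 => x _; rewrite lee_fin sumr_ge0// => i _; exact: sqr_ge0.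
rewrite EE; have [r4|r4] := leP r 4^-1; last first.
  (* For [r > 1/4]: all values of [f] are within [M / 2] of the midpoint [b + M / 2], so the
     variance is at most [M^2 / 4]. *)
  apply: le_trans (variance_le_sqr_dev P (b + M / 2) mf fK) _.
  apply: (@le_trans _ _ (r * M ^+ 2)%:E); last by rewrite leeDr// mule_ge0 ?lee_fin.
  rewrite -(integral_prob_cst P); apply: ge0_le_integral => //.
  - by move=> x _; rewrite lee_fin sqr_ge0.
  - by apply/measurable_EFinP; apply: measurable_funX; exact: measurable_funB.
  move=> x _; rewrite lee_fin; have /andP[h1 h2] := fb x.
  apply: (@le_trans _ _ (4^-1 * M ^+ 2)); last by rewrite ler_wpM2r ?sqr_ge0// ltW.
  by nra.
have hp : C1_rV (fun x => f x - b) (fun i => partial i f).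
  case: fp => cf cp df; split => //.
  - by move=> x; apply: continuousB; [exact: cf|exact: cst_continuous].
  - by move=> i x; have dfx := df i x; apply: is_derive_eq; rewrite subr0.
have [u _ H] := cauchy_wpi_bounded nu0 P_density hp fb r0 r4.
apply: le_trans (variance_le_sqr_dev P (b + u) mf fK) _.
under eq_integral do rewrite opprD addrA.
apply: le_trans H _; rewrite leeD2r//; apply: lee_wpmul2r => //.
(* For nonzero [r] the real power unfolds to an exponential, which is [r^(-1/a)] with
   [a = nu / 2]. *)
rewrite lee_fin /beta /powR gt_eqF//.
rewrite (_ : - (2 / nu) * ln r = - (ln r / (nu / 2))); last by field; rewrite gt_eqF.
by rewrite lerDr divr_ge0// ltW.
Qed.

Lemma weak_poincare_cauchy :
  weak_poincare P beta (fun f : 'rV[R]_d -> R => (Osc f ^+ 2)%E).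
Proof.
split.
- by move=> r _; exact: beta0.
- move=> r s r0 rs; rewrite /beta lerD2l ler_wpM2l//.
  rewrite !powRN lef_pV2 ?posrE ?powR_gt0//; last exact: lt_le_trans rs.
  apply: ge0_ler_powR => //; rewrite ?nnegrE ?divr_ge0// ltW//.
  exact: lt_le_trans rs.
- by move=> f _; rewrite expe2 mule_ge0 ?Osc_ge0.
- move=> a c f _; rewrite Osc_affine !expe2 muleACA -EFinM -expr2.
  by rewrite real_normK ?num_real.
- move=> f fC r r0.
  have E0 : (0 <= 'E_P[fun x => (enorm (grad f x) ^+ 2)%R])%E.
    by apply: expectation_ge0 => x; exact: sqr_ge0.
  have := Osc_ge0 f; case EM : (Osc f) => [M| |]// _; last first.
    (* Infinite oscillation: the right side is [+oo] once the gradient term is known not to be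
       [-oo]. *)
    rewrite expe2 mulyy gt0_muley ?lte_fin// addey ?leey//.
    by rewrite gt_eqF// (lt_le_trans _ (mule_ge0 _ E0)) ?lee_fin ?ltNye.
  by rewrite -EFin_expe -EFinM; exact: cauchy_variance_le.
Qed.

End weak_poincare_cauchy.

Theorem proposition7 (R : realType) (d : nat) (nu : R) (nu_gt0 : 0 < nu) :
  (exists pi : probability 'rV[R]_d R,
     has_density_propto_exp (cauchy_potential nu) pi) /\
  (forall pi : probability 'rV[R]_d R,
     has_density_propto_exp (cauchy_potential nu) pi ->
     weak_poincare pi
       (fun r : R => 2 / nu + 2 * (d%:R / nu + 1) * r `^ (- (2 / nu)))
       (fun f : 'rV[R]_d -> R => (Osc f ^+ 2)%E)).
Proof.
(* Normalizability of [exp (- V)] keeps the second clause from being vacuous. *)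
split; first exact: exists_cauchy_probability.
by move=> pi pi_density; exact: weak_poincare_cauchy.
Qed.
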